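(* There exists an absolute constant $c_0>0$ such that the following holds. Let $\Delta>0$ and let $u$ be a subharmonic function in $\mathbf{C}$ which is ridge, i.e. $u(z)\le u(i\,\mathrm{Im}\,z)$ for all $z\in\mathbf{C}$, and which satisfies $$\liminf_{r\to\infty}\frac{\log\max\{u(ir),u(-ir)\}}{r}=0.$$ Suppose that $u$ is harmonic in the vertical strip $S(\Delta)=\{z\in\mathbf{C}:|\mathrm{Re}\,z|<\Delta\}$ and is normalized by $u(0)=u_x(0)=u_y(0)=0$ and $u_{yy}(0)=1$. Then $$\left|u(z)+\mathrm{Re}\,(z^2/2)\right|\le \frac{c_0|z|^3}{\Delta}\quad\text{for all } z\in\mathbf{C}\text{ with }|z|\le \Delta/3.$$
   Context: Write $z=x+iy$ with $x,y$ real; subscripts $x,y$ on $u$ denote partial derivatives with respect to $x=\mathrm{Re}\,z$ and $y=\mathrm{Im}\,z$. ''Absolute constant'' means that $c_0$ depends on neither $u$ nor $\Delta$. *)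

(* Defs.v *)
(* MathComp-Analysis. The complex plane is R[i] for an arbitrary R : realType;
   it is written R[i]^o where its topology (given by the modulus) is used. *)
From mathcomp Require Import all_boot all_order all_algebra.
From mathcomp Require Import all_classical all_reals all_analysis.
From mathcomp Require Import complex.

Set Implicit Arguments.
Unset Strict Implicit.
Unset Printing Implicit Defensive.

Import Order.TTheory GRing.Theory Num.Theory.
Import numFieldNormedType.Exports.

Local Open Scope classical_set_scope.
Local Open Scope ring_scope.
Local Open Scope complex_scope.

Definition modulus (R : realType) (z : R[i]) : R := complex.Re `|z|.

Definition restr_x (R : realType) (h : R[i] -> R) (z : R[i]) : R -> R :=
  fun t => h (t +i* complex.Im z).

Definition restr_y (R : realType) (h : R[i] -> R) (z : R[i]) : R -> R :=
  fun t => h (complex.Re z +i* t).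

(* h_x and h_y; junk values where the derivative does not exist. *)
Definition partial_x (R : realType) (h : R[i] -> R) : R[i]^o -> R :=
  fun z => derive1 (restr_x h z) (complex.Re z).

Definition partial_y (R : realType) (h : R[i] -> R) : R[i]^o -> R :=
  fun z => derive1 (restr_y h z) (complex.Im z).

(* Meaningful for open D only. *)
Definition C1_on (R : realType) (D : set R[i]^o) (h : R[i] -> R) : Prop :=
  forall z, D z ->
    [/\ derivable (restr_x h z) (complex.Re z) 1,
        derivable (restr_y h z) (complex.Im z) 1,
        {for z, continuous (partial_x h)} &
        {for z, continuous (partial_y h)}].

Definition C2_on (R : realType) (D : set R[i]^o) (h : R[i] -> R) : Prop :=
  [/\ C1_on D h, C1_on D (partial_x h) & C1_on D (partial_y h)].

Definition laplacian (R : realType) (h : R[i] -> R) (z : R[i]) : R :=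
  partial_x (partial_x h) z + partial_y (partial_y h) z.

Definition harmonic_on (R : realType) (D : set R[i]^o) (u : R[i] -> \bar R) :
    Prop :=
  [/\ open D,
      (forall z, D z -> u z \is a fin_num),
      C2_on D (fine \o u) &
      (forall z, D z -> laplacian (fine \o u) z = 0)].

Definition circle_mean (R : realType) (u : R[i] -> \bar R) (w : R[i]) (r : R) :
    \bar R :=
  (((2 * pi)^-1)%:E *
   \int[lebesgue_measure]_(t in `[0%R, (2 * pi)%R])
      u (w + r%:C * (cos t +i* sin t))%R)%E.

Definition upper_semicontinuous (R : realType) (u : R[i]^o -> \bar R) : Prop :=
  lower_semicontinuous (\- u)%E.

(* Subharmonic in the whole plane, by the local submean inequality. The value
   -oo is allowed. The integral in circle_mean is well defined: by upper
   semicontinuity u is bounded above on circles. *)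
Definition subharmonic (R : realType) (u : R[i] -> \bar R) : Prop :=
  [/\ upper_semicontinuous u,
      (forall z, u z < +oo)%E &
      (forall w, exists2 rho : R, 0 < rho &
         forall r : R, 0 <= r < rho -> (u w <= circle_mean u w r)%E)].

Definition ridge (R : realType) (u : R[i] -> \bar R) : Prop :=
  forall z, (u z <= u (0%R +i* complex.Im z))%E.

Definition strip (R : realType) (Delta : R) : set R[i]^o :=
  [set z | `|complex.Re z| < Delta].

(* Main.v *)
Require Import Defs.
From mathcomp Require Import all_boot all_order all_algebra.
From mathcomp Require Import all_classical all_reals all_analysis.
From mathcomp Require Import complex ring lra.

Set Implicit Arguments.
Unset Strict Implicit.
Unset Printing Implicit Defensive.

Import Order.TTheory GRing.Theory Num.Theory.
Import numFieldNormedType.Exports.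

Local Open Scope classical_set_scope.
Local Open Scope ring_scope.
Local Open Scope complex_scope.

(** Scale so that Delta = 1 and, for each side of the imaginary axis, let F be
    the even extension of u from that side. The ridge property makes the axis
    a set of horizontal maxima, so u_x = 0 there and F is harmonic in the
    strip |x| < 1 (harm_on_even_extension); it suffices to prove the estimate
    for the two functions F.

    The ridge property also gives F (0, y)'' = - F_xx (0, y) >= 0, so F is
    nonnegative and convex on the axis, where its growth is thus controlled;
    Harnack's inequality extends the control to the strip (er_lower).
    Reflecting F in a line x = a with 0 < a < 1 / 2, the difference
    F (a + x, y) - F (a - x, y) vanishes for x = 0 and is at most 0 for x = a;
    by a Phragmen-Lindelof argument it is at most 0 in between
    (er_reflect_le). Hence F (t, y) <= F (s, y) if 0 <= s <= t and s + t < 1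
    (er_decreasing), and the function F (x - s, y) - F (x + s, y), odd in x, is
    nonnegative for 0 <= x < 1 / 2 and 0 < s < 1 / 2.

    The boundary Harnack inequality (boundary_harnack) bounds that function by
    its values close to the origin, which the normalization fixes: it is at
    most C x s for small s. Summing over a chain of points,
    F (0, y) - F (x, y) <= C x^2 with an absolute C (er_quadratic). Then
    - F_xx <= 2 C on the axis, so F (0, y) <= C y^2, and F is bounded on a disc
    of fixed radius. A bounded harmonic function has a Taylor remainder of
    order |z|^3 with an absolute constant, and the terms up to order 2 are
    those prescribed by the normalization (even_cubic_remainder).

    No integral is used. Harmonicity is the condition that the four-point
    Laplacian is o (h^2), which suffices for the maximum principle
    (max_principle). The Poisson formula is replaced by averages of Poisson
    kernels over roots of unity, which approximate a harmonic function
    uniformly on smaller discs (poisson_approx). *)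

(** * Subharmonicity by four-point Laplacians, and the maximum principle *)

Definition cross_sum (R : realType) (f : R * R -> R) (p : R * R) (h : R) : R :=
  f (p.1 + h, p.2) + f (p.1 - h, p.2) + f (p.1, p.2 + h) + f (p.1, p.2 - h)
  - 4 * f p.

(** This weakening of a nonnegative Laplacian is all that the maximum
    principle needs, and unlike a condition on second derivatives it survives
    the gluing of a function with its mirror image across a line. *)
Definition subh (R : realType) (f : R * R -> R) (p : R * R) : Prop :=
  forall e : R, 0 < e ->
    \forall h \near (0 : R)^'+, - (e * h ^+ 2) <= cross_sum f p h.

Definition harm (R : realType) (f : R * R -> R) (p : R * R) : Prop :=
  subh f p /\ subh (fun q => - f q) p.

Lemma subhD (R : realType) (f g : R * R -> R) p :
  subh f p -> subh g p -> subh (fun q => f q + g q) p.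
Proof.
move=> sf sg e e0; have e20 : 0 < e / 2 by lra.
near=> h.
have H1 : - (e / 2 * h ^+ 2) <= cross_sum f p h by near: h; exact: sf.
have H2 : - (e / 2 * h ^+ 2) <= cross_sum g p h by near: h; exact: sg.
have -> : cross_sum (fun q => f q + g q) p h = cross_sum f p h + cross_sum g p h.
  by rewrite /cross_sum; ring.
by move: H1 H2; set s := h ^+ 2; lra.
Unshelve. all: by end_near. Qed.

Lemma subhZ (R : realType) (f : R * R -> R) p (c : R) :
  0 <= c -> subh f p -> subh (fun q => c * f q) p.
Proof.
move=> c0 sf e e0; have e1 : 0 < e / (c + 1) by rewrite divr_gt0//; lra.
near=> h.
have H1 : - (e / (c + 1) * h ^+ 2) <= cross_sum f p h by near: h; exact: sf.
have -> : cross_sum (fun q => c * f q) p h = c * cross_sum f p h.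
  by rewrite /cross_sum; ring.
apply: le_trans (ler_wpM2l c0 H1).
have -> : c * - (e / (c + 1) * h ^+ 2) = - (e * h ^+ 2 * (c / (c + 1))) by ring.
rewrite lerN2 ler_piMr//; first by rewrite mulr_ge0 ?sqr_ge0// ltW.
by rewrite ler_pdivrMr; lra.
Unshelve. all: by end_near. Qed.

Lemma harmN (R : realType) (f : R * R -> R) p :
  harm f p -> harm (fun q => - f q) p.
Proof.
by move=> [h1 h2]; split=> //; under eq_fun do rewrite opprK.
Qed.

Lemma harmD (R : realType) (f g : R * R -> R) p :
  harm f p -> harm g p -> harm (fun q => f q + g q) p.
Proof.
move=> [f1 f2] [g1 g2]; split; first exact: subhD.
by under eq_fun do rewrite opprD; exact: subhD.
Qed.

Lemma harmB (R : realType) (f g : R * R -> R) p :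
  harm f p -> harm g p -> harm (fun q => f q - g q) p.
Proof. by move=> hf /harmN hg; exact: harmD. Qed.

Lemma harmZ (R : realType) (f : R * R -> R) p (c : R) :
  harm f p -> harm (fun q => c * f q) p.
Proof.
wlog c0 : c f / 0 <= c => [H hf|].
  have [|c0] := leP 0 c; first by move/H; exact.
  have -> : (fun q => c * f q) = (fun q => - c * - f q).
    by apply/funext => q; rewrite mulrNN.
  by apply: H; [rewrite oppr_ge0 ltW|exact: harmN].
move=> [h1 h2]; split; first exact: subhZ.
by under eq_fun do rewrite -mulrN; exact: subhZ.
Qed.

Lemma harm_cst (R : realType) (c : R) p : harm (fun=> c) p.
Proof.
suff H (a : R) : subh (fun=> a) p by split; exact: H.
move=> e e0; near=> h; rewrite /cross_sum.
have -> : a + a + a + a - 4 * a = 0 by ring.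
by rewrite oppr_le0 mulr_ge0 ?sqr_ge0// ltW.
Unshelve. all: by end_near. Qed.

Lemma near0r_scale (R : realType) (P : R -> Prop) (c : R) : 0 < c ->
  (\forall h \near (0 : R)^'+, P h) -> \forall h \near (0 : R)^'+, P (c * h).
Proof.
move=> c0; rewrite /at_right !near_withinE !near_simpl => H.
have : (fun h : R => c * h) @ (0 : R) --> (0 : R).
  by rewrite -[X in _ --> X](mulr0 c); apply: cvgMl_tmp; exact: cvg_id.
move=> /(_ _ H); rewrite !near_simpl; apply: filterS => h Ph h0.
by apply: Ph; rewrite mulr_gt0.
Qed.

Lemma subh_affine (R : realType) (f : R * R -> R) (c a b : R) (p : R * R) :
  0 < c -> subh f (c * p.1 + a, c * p.2 + b) ->
  subh (fun q => f (c * q.1 + a, c * q.2 + b)) p.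
Proof.
move=> c0 sf e e0; have e1 : 0 < e / c ^+ 2 by rewrite divr_gt0// exprn_gt0.
have := near0r_scale c0 (sf _ e1); apply: filterS => h /=.
have -> : e / c ^+ 2 * (c * h) ^+ 2 = e * h ^+ 2.
  by field; rewrite gt_eqF.
move=> /le_trans; apply; rewrite le_eqVlt; apply/orP; left; apply/eqP.
rewrite /cross_sum /=.
by congr (f (_, _) + f (_, _) + f (_, _) + f (_, _) - _); ring.
Qed.

Lemma harm_affine (R : realType) (f : R * R -> R) (c a b : R) (p : R * R) :
  0 < c -> harm f (c * p.1 + a, c * p.2 + b) ->
  harm (fun q => f (c * q.1 + a, c * q.2 + b)) p.
Proof.
by move=> c0 [h1 h2]; split; [exact: subh_affine|
  exact: (@subh_affine _ (fun q => - f q))].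
Qed.

Lemma harm_reflect (R : realType) (f : R * R -> R) (p : R * R) :
  harm f (- p.1, p.2) -> harm (fun q => f (- q.1, q.2)) p.
Proof.
suff H (g : R * R -> R) : subh g (- p.1, p.2) -> subh (fun q => g (- q.1, q.2)) p.
  by move=> [h1 h2]; split; [exact: H|exact: (H (fun q => - f q))].
move=> sg e e0; move: (sg e e0); apply: filterS => h.
move=> /le_trans; apply; rewrite le_eqVlt; apply/orP; left; apply/eqP.
rewrite /cross_sum /= !opprD !opprK.
by rewrite [X in X + _ + _ - _ = _]addrC.
Qed.

Lemma cvg_line (R : realType) (q a : R) : (fun h : R => q + a * h) @ (0 : R) --> q.
Proof.
have : (fun h : R => q + a * h) @ (0 : R) --> q + a * 0.
  by apply: cvgD; [exact: cvg_cst|apply: cvgMl_tmp; exact: cvg_id].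
by rewrite mulr0 addr0.
Qed.

Lemma near_cross (R : realType) (K : set (R * R)) (p : R * R) : nbhs p K ->
  \forall h \near (0 : R)^'+, [/\ K (p.1 + h, p.2), K (p.1 - h, p.2),
     K (p.1, p.2 + h) & K (p.1, p.2 - h)].
Proof.
move=> Kp.
have P (a b : R) : \forall h \near (0 : R)^'+, K (p.1 + a * h, p.2 + b * h).
  apply: cvg_within.
  have H : (fun h : R => (p.1 + a * h, p.2 + b * h)) @ (0 : R) --> p.
    suff : (fun h : R => (p.1 + a * h, p.2 + b * h)) @ (0 : R) --> (p.1, p.2).
      by rewrite -surjective_pairing.
    apply: (@cvg_pair _ _ _ (nbhs (0 : R)) (nbhs p.1) (nbhs p.2));
      exact: cvg_line.
  exact: H.
near=> h; split.
- by have : K (p.1 + 1 * h, p.2 + 0 * h);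
    [near: h; exact: P|rewrite mul1r mul0r addr0].
- by have : K (p.1 + (-1) * h, p.2 + 0 * h);
    [near: h; exact: P|rewrite mulN1r mul0r addr0].
- by have : K (p.1 + 0 * h, p.2 + 1 * h);
    [near: h; exact: P|rewrite mul1r mul0r addr0].
- by have : K (p.1 + 0 * h, p.2 + (-1) * h);
    [near: h; exact: P|rewrite mulN1r mul0r addr0].
Unshelve. all: by end_near. Qed.

(** Where a small multiple of x ^+ 2 is added to f, the four-point Laplacian
    becomes strictly positive, which is impossible at a maximum. *)
Lemma max_principle (R : realType) (K : set (R * R)) (f : R * R -> R) :
  compact K -> (forall p, K p -> {for p, continuous f}) ->
  (forall p, K p -> f p <= 0 \/ (nbhs p K /\ subh f p)) ->
  forall p, K p -> f p <= 0.
Proof.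
move=> cK cf dich p0 Kp0; rewrite leNgt; apply/negP => fp0.
have K0 : K !=set0 by exists p0.
have cx2 (p : R * R) : {for p, continuous (fun q : R * R => q.1 ^+ 2)}.
  by apply: cvgM; exact: cvg_fst.
have cwithin (g : R * R -> R) : (forall p, K p -> {for p, continuous g}) ->
    {within K, continuous g}.
  move=> cg; apply/continuous_in_subspaceT => p /set_mem; exact: cg.
have [m /set_mem Km mmax] := compact_EVT_max K0 cK (cwithin _ (fun p _ => cx2 p)).
set M := m.1 ^+ 2 in mmax.
have M0 : 0 <= M by exact: sqr_ge0.
pose d := f p0 / (M + 1).
have d0 : 0 < d by rewrite divr_gt0//; lra.
have dM : d * M < f p0.
  by rewrite /d mulrAC ltr_pdivrMr; [rewrite ltr_pM2l//|]; lra.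
have cg p : K p -> {for p, continuous (fun q : R * R => f q + d * q.1 ^+ 2)}.
  move=> Kp; apply: cvgD; first exact: cf.
  exact: cvgMl_tmp (cx2 p).
have [q /set_mem Kq qmax] := compact_EVT_max K0 cK (cwithin _ cg).
have H0 : f p0 <= f q + d * q.1 ^+ 2.
  apply: le_trans (qmax p0 (mem_set Kp0)).
  by rewrite lerDl mulr_ge0 ?sqr_ge0// ltW.
have qM : q.1 ^+ 2 <= M by apply: mmax; exact: mem_set.
have dqM : d * q.1 ^+ 2 <= d * M by rewrite ler_pM2l.
case: (dich q Kq) => [fq|[nK sf]]; first by move: H0 dqM dM fq; lra.
have := filter_ex (filterI (nbhs_right_gt (0 : R)) (filterI (near_cross nK) (sf d d0))).
move=> [h [h0 [[K1 K2 K3 K4]]]]; rewrite /cross_sum.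
have := qmax _ (mem_set K1); have := qmax _ (mem_set K2).
have := qmax _ (mem_set K3); have := qmax _ (mem_set K4) => /=.
have dh : 0 < d * h ^+ 2 by rewrite mulr_gt0// exprn_gt0.
have -> : d * (q.1 + h) ^+ 2 = d * q.1 ^+ 2 + 2 * (d * (q.1 * h)) + d * h ^+ 2 by ring.
have -> : d * (q.1 - h) ^+ 2 = d * q.1 ^+ 2 - 2 * (d * (q.1 * h)) + d * h ^+ 2 by ring.
move: dh; set a := d * h ^+ 2; set b := d * (q.1 * h); set c := d * _.
lra.
Qed.

(** * Poisson kernels at roots of unity *)

Definition sqnorm (R : realType) (p : R * R) : R := p.1 ^+ 2 + p.2 ^+ 2.

Definition disc (R : realType) (r : R) : set (R * R) :=
  [set p | sqnorm p <= r ^+ 2].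

Definition toC (R : realType) (p : R * R) : R[i] := p.1 +i* p.2.

Definition pois (R : realType) (z p : R * R) : R :=
  (sqnorm z - sqnorm p) / ((z.1 - p.1) ^+ 2 + (z.2 - p.2) ^+ 2).

Lemma modulusE (R : realType) (z : R[i]) :
  modulus z = Num.sqrt (complex.Re z ^+ 2 + complex.Im z ^+ 2).
Proof. by case: z. Qed.

Lemma norm_modulus (R : realType) (z : R[i]) : `|z| = (modulus z)%:C.
Proof. by case: z. Qed.

Lemma modulus_ge0 (R : realType) (z : R[i]) : 0 <= modulus z.
Proof. by rewrite modulusE sqrtr_ge0. Qed.

Lemma sqr_modulus (R : realType) (z : R[i]) :
  modulus z ^+ 2 = complex.Re z ^+ 2 + complex.Im z ^+ 2.
Proof. by rewrite modulusE sqr_sqrtr// addr_ge0// sqr_ge0. Qed.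

Lemma modulusM (R : realType) (z w : R[i]) :
  modulus (z * w) = modulus z * modulus w.
Proof.
by apply: (@complexI R); rewrite rmorphM/= -!norm_modulus normrM.
Qed.

Lemma modulusX (R : realType) (z : R[i]) n : modulus (z ^+ n) = modulus z ^+ n.
Proof.
by apply: (@complexI R); rewrite rmorphXn/= -!norm_modulus normrX.
Qed.

Lemma modulusV (R : realType) (z : R[i]) : modulus z^-1 = (modulus z)^-1.
Proof.
by apply: (@complexI R); rewrite fmorphV/= -!norm_modulus normfV.
Qed.

Lemma modulusB (R : realType) (z w : R[i]) :
  modulus z - modulus w <= modulus (z - w).
Proof.
by rewrite -lecR rmorphB/= -!norm_modulus lerB_dist.
Qed.

Lemma modulusN (R : realType) (z : R[i]) : modulus (- z) = modulus z.
Proof. by rewrite !modulusE; case: z => a b /=; rewrite !sqrrN. Qed.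

Lemma modulusC (R : realType) (x : R) : modulus x%:C = `|x|.
Proof. by rewrite modulusE /= expr0n /= addr0 sqrtr_sqr. Qed.

Lemma modulus_eq0 (R : realType) (z : R[i]) : (modulus z == 0) = (z == 0).
Proof. by rewrite -[RHS]normr_eq0 norm_modulus (inj_eq (@complexI R)). Qed.

Lemma Re_le_modulus (R : realType) (z : R[i]) : `|complex.Re z| <= modulus z.
Proof.
by rewrite modulusE -sqrtr_sqr ler_wsqrtr// lerDl sqr_ge0.
Qed.

Lemma ReD (R : realType) (z w : R[i]) :
  complex.Re (z + w) = complex.Re z + complex.Re w.
Proof. by case: z w => [a b] []. Qed.

Lemma sqnorm_toC (R : realType) (p : R * R) : sqnorm p = modulus (toC p) ^+ 2.
Proof. by rewrite sqr_modulus. Qed.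

Lemma pois_toC (R : realType) (z p : R * R) :
  pois z p = complex.Re ((toC z + toC p) / (toC z - toC p)).
Proof.
rewrite /pois /toC /sqnorm /=; ring.
Qed.

Lemma pois_toC' (R : realType) (z p : R * R) : z != p ->
  pois z p = complex.Re (2 * toC z / (toC z - toC p)) - 1.
Proof.
move=> zp; have D0 : toC z - toC p != 0.
  rewrite subr_eq0; apply: contra_neq zp => -[].
  by case: z p => [a b] [x y] /= -> ->.
rewrite pois_toC.
have -> : (toC z + toC p) / (toC z - toC p) =
   2 * toC z / (toC z - toC p) + (-1)%:C.
  by rewrite rmorphN /=; field.
by rewrite ReD.
Qed.

(** The sum of 1 / (D + i^k h) over k < 4 is the logarithmic derivative of
    w^4 - h^4 at w = D, that is 4 D^3 / (D^4 - h^4); its distance to 4 / D is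
    of order h^4. *)
Lemma harm_pois (R : realType) (z p : R * R) : z != p -> harm (pois z) p.
Proof.
move=> zp; set D := toC z - toC p.
have D0 : D != 0.
  rewrite subr_eq0; apply: contra_neq zp => -[].
  by case: z p {D} => [a b] [x y] /= -> ->.
have m0 : 0 < modulus D by rewrite lt_def modulus_eq0 D0 modulus_ge0.
suff H : forall e : R, 0 < e ->
    \forall h \near (0 : R)^'+, `|cross_sum (pois z) p h| <= e * h ^+ 2.
  split=> e e0; move: (H e e0); apply: filterS => h; rewrite ler_norml => /andP[] //.
  move=> _ h1; rewrite -[X in _ <= X]opprK lerN2; apply: le_trans h1.
  by rewrite /cross_sum; lra.
move=> e e0; set m := modulus D in m0; set k := modulus (toC z).
have k0 : 0 <= k by exact: modulus_ge0.
pose c := e * m ^+ 5 / (16 * k + 1).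
have c0 : 0 < c by rewrite divr_gt0 ?mulr_gt0 ?exprn_gt0//; lra.
near=> h.
have h0 : 0 < h by [].
have hm : h < m / 2 by near: h; apply: nbhs_right_lt; lra.
have hc : h < c by near: h; exact: nbhs_right_lt.
have h1 : h < 1 by near: h; apply: nbhs_right_lt; lra.
have ne (w : R[i]) : modulus w = h -> D - w != 0.
  by move=> wh; rewrite -modulus_eq0 gt_eqF//; apply: lt_le_trans (modulusB _ _);
     rewrite wh -/m; lra.
have mi : modulus ('i%C * h%:C : R[i]) = h.
  rewrite modulusM modulusC gtr0_norm// modulusE /= expr0n/= add0r expr1n sqrtr1.
  by rewrite mul1r.
have mNi : modulus (- ('i%C * h%:C) : R[i]) = h.
  by rewrite modulusN.
have mh : modulus (h%:C : R[i]) = h by rewrite modulusC gtr0_norm.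
have mNh : modulus ((- h)%:C : R[i]) = h by rewrite modulusC normrN gtr0_norm.
have val (a b : R) : modulus (a +i* b) = h ->
    pois z (p.1 + a, p.2 + b) = complex.Re (2 * toC z / (D - (a +i* b))) - 1.
  move=> mab; have E : toC z - toC (p.1 + a, p.2 + b) = D - (a +i* b).
    by rewrite /D /toC; apply/eqP; rewrite eq_complex /=; apply/andP; split; apply/eqP; ring.
  rewrite pois_toC' ?E//; apply: contraTneq (ne _ mab) => zp'.
  by rewrite -E zp' subrr eqxx.
have i2 : 'i%C ^+ 2 = -1 :> R[i] by exact: sqr_i.
have E : cross_sum (pois z) p h =
    complex.Re (8 * toC z * h%:C ^+ 4 / (D * (D ^+ 4 - h%:C ^+ 4))).
  rewrite /cross_sum.
  have -> : pois z (p.1 + h, p.2) = pois z (p.1 + h, p.2 + 0) by rewrite addr0.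
  have -> : pois z (p.1 - h, p.2) = pois z (p.1 - h, p.2 + 0) by rewrite addr0.
  have -> : pois z (p.1, p.2 + h) = pois z (p.1 + 0, p.2 + h) by rewrite addr0.
  have -> : pois z (p.1, p.2 - h) = pois z (p.1 + 0, p.2 - h) by rewrite addr0.
  have e3 : 0 +i* h = 'i%C * h%:C :> R[i].
    by apply/eqP; rewrite eq_complex /=; apply/andP; split; apply/eqP; ring.
  have e4 : 0 +i* (- h) = - ('i%C * h%:C) :> R[i].
    by apply/eqP; rewrite eq_complex /=; apply/andP; split; apply/eqP; ring.
  have e2 : (- h) +i* 0 = - h%:C :> R[i].
    by apply/eqP; rewrite eq_complex /=; apply/andP; split; apply/eqP; ring.
  rewrite (val h 0)// (val (- h) 0)// (val 0 h) ?e3// (val 0 (- h)) ?e4//.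
  rewrite pois_toC'// -/D e2 !opprK -/(h%:C).
  set t := toC z; set w := h%:C in mh *.
  have n1 : D - w != 0 by apply: ne.
  have n2 : D + w != 0.
    by rewrite -[w]opprK -e2; apply: ne.
  have n3 : D - 'i%C * w != 0 by apply: ne.
  have n4 : D + 'i%C * w != 0 by rewrite -['i%C * w]opprK; apply: ne.
  have n5 : D ^+ 4 - w ^+ 4 != 0.
    have -> : D ^+ 4 - w ^+ 4 = (D - w) * (D + w) * ((D - 'i%C * w) * (D + 'i%C * w)).
      have -> : (D - 'i%C * w) * (D + 'i%C * w) = D ^+ 2 - 'i%C ^+ 2 * w ^+ 2 by ring.
      by rewrite i2; ring.
    by rewrite !mulf_neq0.
  have E2 : 2 * t / (D - 'i%C * w) + 2 * t / (D + 'i%C * w) =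
      4 * t * D / (D ^+ 2 + w ^+ 2).
    have q : D ^+ 2 + w ^+ 2 = (D - 'i%C * w) * (D + 'i%C * w).
      have -> : (D - 'i%C * w) * (D + 'i%C * w) = D ^+ 2 - 'i%C ^+ 2 * w ^+ 2 by ring.
      by rewrite i2; ring.
    by rewrite q; field; rewrite n3 n4.
  have n6 : D ^+ 2 + w ^+ 2 != 0.
    apply: contraNneq n5 => q.
    have -> : D ^+ 4 - w ^+ 4 = (D ^+ 2 + w ^+ 2) * (D ^+ 2 - w ^+ 2) by ring.
    by rewrite q mul0r.
  have -> : 8 * t * w ^+ 4 / (D * (D ^+ 4 - w ^+ 4)) =
     2 * t / (D - w) + 2 * t / (D + w) + 4 * t * D / (D ^+ 2 + w ^+ 2)
     + (-4)%:C * (2 * t / D).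
    rewrite rmorphN /= rmorph_nat; field.
    by rewrite n1 n2 n5 n6 D0.
  rewrite -E2 !ReD.
  have -> : complex.Re ((-4)%:C * (2 * t / D)) = - 4 * complex.Re (2 * t / D).
    by case: (2 * t / D) => a b /=; ring.
  ring.
rewrite E; apply: le_trans (Re_le_modulus _) _.
rewrite !(modulusM, modulusV, modulusX) mh -/k -/m.
have -> : modulus (8 : R[i]) = 8.
  have -> : (8 : R[i]) = (8 : R)%:C by rewrite rmorph_nat.
  by rewrite modulusC normr_nat.
have hm4 : h ^+ 4 <= m ^+ 4 / 2.
  have : h ^+ 4 <= (m / 2) ^+ 4 by rewrite ler_pXn2r ?nnegrE//; lra.
  have : 0 <= m ^+ 4 by rewrite exprn_ge0// ltW.
  by rewrite expr_div_n; set a := m ^+ 4; lra.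
have dm : m ^+ 4 / 2 <= modulus (D ^+ 4 - h%:C ^+ 4).
  apply: le_trans (modulusB _ _); rewrite !modulusX mh -/m; lra.
have m4 : 0 < m ^+ 4 / 2 by rewrite divr_gt0// exprn_gt0.
apply: (@le_trans _ _ (8 * k * h ^+ 4 / (m * (m ^+ 4 / 2)))).
  rewrite ler_wpM2l//; first by rewrite !mulr_ge0// ?exprn_ge0// ltW.
  rewrite lef_pV2 ?posrE ?mulr_gt0// ?(lt_le_trans m4)//.
  by rewrite ler_pM2l.
have -> : 8 * k * h ^+ 4 / (m * (m ^+ 4 / 2)) = 16 * k * h ^+ 2 / m ^+ 5 * h ^+ 2.
  by field; rewrite gt_eqF.
rewrite ler_wpM2r ?sqr_ge0// ler_pdivrMr ?exprn_gt0//.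
have hh : h ^+ 2 <= c.
  by apply: le_trans (ltW hc); rewrite expr2 ler_piMl// ltW.
apply: (@le_trans _ _ ((16 * k + 1) * c)).
  apply: (@le_trans _ _ (16 * k * c)); first by rewrite ler_wpM2l//; lra.
  by rewrite ler_wpM2r//; lra.
by rewrite /c mulrCA divff ?mulr1//; lra.
Unshelve. all: by end_near. Qed.

Lemma deriv_prod_XsubC (F : fieldType) (r : seq F) (q : F) : q \notin r ->
  (\prod_(z <- r) ('X - z%:P))^`().[q] =
  (\prod_(z <- r) ('X - z%:P)).[q] * \sum_(z <- r) (q - z)^-1.
Proof.
elim: r => [_|z r IH]; first by rewrite !big_nil derivC hornerC mulr0.
rewrite inE negb_or => /andP[qz /IH {}IH].
rewrite !big_cons derivM hornerD !hornerM IH derivXsubC hornerC hornerXsubC.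
have n0 : q - z != 0 by rewrite subr_eq0.
by field.
Qed.

(** With q the evaluation point and z running over the N-th roots of unity,
    (z + q) / (z - q) = 1 + 2 q / (z - q), and the sum of 1 / (q - z) is the
    logarithmic derivative of 'X^N - 1; so the mean is (1 + q^N) / (1 - q^N),
    which tends to 1 uniformly on smaller discs. *)
Lemma poisson_nodes (R : realType) (rho eps : R) :
  0 < rho -> rho < 1 -> 0 < eps ->
  exists2 rs : seq (R * R),
    (0 < size rs)%N /\ (forall z, z \in rs -> sqnorm z = 1) &
    forall p, sqnorm p <= rho ^+ 2 ->
      `|(size rs)%:R^-1 * \sum_(z <- rs) pois z p - 1| <= eps.
Proof.
move=> rho0 rho1 eps0.
have [n [n0 hn]] : exists n, (0 < n)%N /\ rho ^+ n <= Num.min (1 / 2) (eps / 4).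
  have m0 : 0 < Num.min (1 / 2) (eps / 4) by rewrite lt_min; apply/andP; split; lra.
  have H := @cvg_expr R rho; rewrite gtr0_norm// in H.
  have /cvgrPdist_le/(_ _ m0)[N _ HN] := H rho1.
  exists N.+1; split=> //.
  have := HN N.+1 (leqnSn N) => /=.
  by rewrite sub0r normrN ger0_norm// exprn_ge0// ltW.
have : rho ^+ n <= 1 / 2 by move: hn; rewrite le_min => /andP[].
have {hn} : rho ^+ n <= eps / 4 by move: hn; rewrite le_min => /andP[].
move=> hn1 hn2.
have [r Hr] := closed_field_poly_normal ('X^n - 1%:P : {poly R[i]}).
have mon : 'X^n - 1%:P \is @monic R[i] by exact: monicXnsubC.
rewrite (monicP mon) scale1r in Hr.
have sr : size r = n.
  have : size (\prod_(z <- r) ('X - z%:P)) = (size r).+1.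
    exact: size_prod_XsubC.
  by rewrite -Hr size_XnsubC// => -[].
have zr z : z \in r -> z ^+ n = 1.
  rewrite -root_prod_XsubC -Hr /root !hornerE => /eqP/eqP.
  by rewrite subr_eq0 => /eqP.
pose ofC (z : R[i]) : R * R := (complex.Re z, complex.Im z).
have ofCK z : toC (ofC z) = z by case: z.
exists [seq ofC z | z <- r].
  rewrite size_map sr; split=> // _ /mapP[z /zr zn ->].
  rewrite sqnorm_toC ofCK; have : modulus z ^+ n = 1.
    by rewrite -modulusX zn modulusC normr1.
  move/eqP; rewrite pexpr_eq1 ?modulus_ge0// => /eqP ->.
  by rewrite expr1n.
move=> p hp; rewrite size_map sr big_map.
set q := toC p.
have mq : modulus q <= rho.
  by rewrite -(@ler_pXn2r _ 2)// ?nnegrE ?modulus_ge0 ?(ltW rho0)// -sqnorm_toC.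
have mqn : modulus (q ^+ n) <= rho ^+ n.
  by rewrite modulusX lerXn2r// ?nnegrE ?modulus_ge0 ?(ltW rho0).
have m1 : 1 / 2 <= modulus (1 - q ^+ n).
  apply: le_trans (modulusB _ _); rewrite modulusC normr1.
  by move: mqn; move: (modulus _) => t; lra.
have d0 : 1 - q ^+ n != 0.
  by rewrite -modulus_eq0 gt_eqF//; apply: lt_le_trans m1; lra.
have qr : q \notin r.
  by apply: contraNN d0 => /zr ->; rewrite subrr.
have := deriv_prod_XsubC qr; rewrite -Hr derivB derivXn derivC subr0 !hornerE.
rewrite hornerMn !hornerE => LD.
have nR : n%:R != 0 :> R[i] by rewrite pnatr_eq0 -lt0n.
have nR' : n%:R != 0 :> R by rewrite pnatr_eq0 -lt0n.
have S : \sum_(z <- r) (q - z)^-1 = q ^+ n.-1 *+ n / (q ^+ n - 1).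
  have n1 : q ^+ n - 1 != 0 by rewrite -oppr_eq0 opprB.
  by rewrite LD mulrC mulrA mulVf// mul1r.
have E : \sum_(z <- r) pois (ofC z) p =
    n%:R * (1 + complex.Re (2 * q ^+ n / (1 - q ^+ n))).
  have -> : \sum_(z <- r) pois (ofC z) p =
      complex.Re (\sum_(z <- r) (1 - 2 * q * (q - z)^-1)).
    rewrite (big_morph (@complex.Re R) (@ReD R) (erefl _)).
    apply: eq_big_seq => z zrr.
    rewrite pois_toC ofCK -/q; congr complex.Re.
    have n1 : z - q != 0.
      by rewrite subr_eq0; apply: contraNneq qr => <-.
    have n2 : q - z != 0 by rewrite -oppr_eq0 opprB.
    by field; rewrite n1 n2.
  rewrite big_split /= sumrN -mulr_sumr S.
  rewrite big_const_seq count_predT sr iter_addr_0.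
  have -> : 1 *+ n - 2 * q * (q ^+ n.-1 *+ n / (q ^+ n - 1)) =
      (n%:R)%:C * (1 + 2 * q ^+ n / (1 - q ^+ n)).
    have n1 : q ^+ n - 1 != 0 by rewrite -oppr_eq0 opprB.
    have -> : q ^+ n = q * q ^+ n.-1 by rewrite -exprS prednK.
    rewrite -mulr_natr rmorph_nat; field.
    by rewrite -exprS prednK// d0 n1.
  by case: (2 * q ^+ n / _) => a b /=; ring.
rewrite E mulKf// addrC addKr.
apply: le_trans (Re_le_modulus _) _.
rewrite !(modulusM, modulusV).
have -> : modulus (2 : R[i]) = 2.
  have -> : (2 : R[i]) = (2 : R)%:C by rewrite rmorph_nat.
  by rewrite modulusC normr_nat.
rewrite ler_pdivrMr; last by apply: lt_le_trans m1; lra.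
move: mqn m1; move: (modulus _) => a; move: (modulus _) => b.
move=> h1 h2; apply: (@le_trans _ _ (eps * (1 / 2))); first by lra.
by rewrite ler_wpM2l// ltW.
Qed.

(** * Approximate Poisson representation *)

Definition sqdist (R : realType) (z p : R * R) : R :=
  (z.1 - p.1) ^+ 2 + (z.2 - p.2) ^+ 2.

Lemma continuous_sqdist (R : realType) (z : R * R) :
  continuous (fun p : R * R => sqdist z p).
Proof.
move=> p; rewrite /sqdist; apply: cvgD.
  have H : (fun q : R * R => z.1 - q.1) @ p --> z.1 - p.1.
    by apply: cvgB; [exact: cvg_cst|exact: cvg_fst].
  exact: cvgM.
have H : (fun q : R * R => z.2 - q.2) @ p --> z.2 - p.2.
  by apply: cvgB; [exact: cvg_cst|exact: cvg_snd].
exact: cvgM.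
Qed.

Lemma continuous_sqnorm (R : realType) : continuous (@sqnorm R).
Proof.
move=> p; rewrite /sqnorm; apply: cvgD.
  by apply: cvgM; exact: cvg_fst.
by apply: cvgM; exact: cvg_snd.
Qed.

Lemma continuous_pois (R : realType) (z p : R * R) : sqdist z p != 0 ->
  {for p, continuous (pois z)}.
Proof.
move=> zp; rewrite /pois; apply: cvgM.
  by apply: cvgB; [exact: cvg_cst|exact: continuous_sqnorm].
by apply: cvgV => //; exact: continuous_sqdist.
Qed.

Lemma closed_disc (R : realType) (r : R) : closed (disc r).
Proof.
apply: (@preimage_closed _ _ (@sqnorm R) [set x | x <= r ^+ 2]).
  by move=> p _; exact: continuous_sqnorm.
exact: closed_le.
Qed.

Lemma compact_disc (R : realType) (r : R) : 0 <= r -> compact (disc r).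
Proof.
move=> r0; apply: (@subclosed_compact _ _ (`[- r, r] `*` `[- r, r])).
- exact: closed_disc.
- by apply: compact_setX; exact: segment_compact.
- move=> [x y]; rewrite /disc /sqnorm /= => H.
  have := sqr_ge0 x; have := sqr_ge0 y => y2 x2.
  by split; rewrite /= in_itv /= -ler_norml -(@ler_pXn2r _ 2)// ?nnegrE//
    real_normK ?num_real//; lra.
Qed.

Lemma nbhs_disc (R : realType) (r : R) (p : R * R) :
  sqnorm p < r ^+ 2 -> nbhs p (disc r).
Proof.
move=> pr; have H : nbhs p [set q | sqnorm q < r ^+ 2].
  exact: (@continuous_sqnorm R p _ (lt_nbhsl pr)).
by apply: filterS H => q /ltW.
Qed.

Lemma disc_sub (R : realType) (r s : R) (p : R * R) :
  0 <= r -> r <= s -> disc r p -> disc s p.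
Proof.
rewrite /disc /= => r0 rs /le_trans; apply.
by rewrite lerXn2r// nnegrE ?(le_trans r0).
Qed.

Lemma compact_bounded_fun (R : realType) (K : set (R * R)) (f : R * R -> R) :
  compact K -> (forall p, K p -> {for p, continuous f}) ->
  exists2 M : R, 0 <= M & forall p, K p -> `|f p| <= M.
Proof.
move=> cK cf; have [K0|K0] := pselect (K !=set0); last first.
  by exists 0 => // p Kp; case: K0; exists p.
have cn : {within K, continuous (fun p => `|f p|)}.
  apply/continuous_in_subspaceT => p /set_mem Kp.
  exact: (cvg_norm (cf p Kp)).
have [m _ mmax] := compact_EVT_max K0 cK cn.
by exists `|f m| => // p Kp; exact: mmax (mem_set Kp).
Qed.

Lemma uniform_continuity (R : realType) (K : set (R * R)) (f : R * R -> R)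
    (e : R) :
  compact K -> (forall p, K p -> {for p, continuous f}) -> 0 < e ->
  exists2 d : R, 0 < d & forall z p, K z -> sqdist z p < d ^+ 2 -> `|f p - f z| <= e.
Proof.
move=> /compact_near_coveringP cK cf e0.
pose P (d : R) (z : R * R) := forall p, sqdist z p < d ^+ 2 -> `|f p - f z| <= e.
have e20 : 0 < e / 2 by lra.
have H : forall x, K x -> \forall x' \near x & d \near (0 : R)^'+, P d x'; last first.
  have HH := cK _ _ P (@at_right_proper_filter R 0) H.
  have := filter_ex (filterI (nbhs_right_gt (0 : R)) HH).
  by move=> [d [d0 Hd]]; exists d => // z p Kz; exact: Hd.
move=> x Kx; have := cf x Kx => /cvgrPdist_lt/(_ _ e20).
move=> /nbhs_ballP[r /= r0 Hr].
have r20 : 0 < r / 2 by rewrite divr_gt0.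
exists (ball x (r / 2), [set d | 0 < d /\ d < r / 2]) => /=.
  split; first exact: nbhsx_ballx.
  near=> d; split; first by [].
  by near: d; exact: nbhs_right_lt.
move=> [z d] /= [[z1 z2] [d0 dr]] p zp.
have cls (a b : R) : a ^+ 2 + b ^+ 2 < d ^+ 2 -> `|a| < d /\ `|b| < d.
  move=> ab; have := sqr_ge0 a; have := sqr_ge0 b => b2 a2.
  by split; rewrite -(@ltr_pXn2r _ 2)// ?nnegrE// ?(ltW d0)// real_normK ?num_real//; lra.
have [c1 c2] := cls _ _ zp.
have Bz : ball x r z.
  by split; [apply: lt_le_trans z1 _|apply: lt_le_trans z2 _]; lra.
have Bp : ball x r p.
  have tri (a b c : R) : `|a - b| < r / 2 -> `|b - c| < d -> `|a - c| < r.
    by move: dr; rewrite !ltr_norml => ? /andP[? ?] /andP[? ?]; apply/andP; split; lra.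
  by split; [exact: tri z1 c1|exact: tri z2 c2].
have /= := Hr _ Bz; have /= := Hr _ Bp.
by rewrite !ltr_norml ler_norml => /andP[? ?] /andP[? ?]; apply/andP; split; lra.
Unshelve. all: by end_near. Qed.

(** Expanding the square, only the scalar product of z and p has to be
    estimated, and Cauchy-Schwarz bounds it by rho. *)
Lemma sqdist_circle (R : realType) (rho : R) (z p : R * R) :
  sqnorm z = 1 -> 0 <= rho -> rho <= 1 -> disc rho p ->
  (1 - rho) ^+ 2 <= sqdist z p <= (1 + rho) ^+ 2.
Proof.
rewrite /disc /sqnorm /sqdist /=; case: z p => [a b] [x y] /= ab r0 r1 xy.
set s := x ^+ 2 + y ^+ 2 in xy; set c := a * x + b * y.
have cs : c ^+ 2 <= s.
  have : c ^+ 2 + (a * y - b * x) ^+ 2 = (a ^+ 2 + b ^+ 2) * s.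
    by rewrite /c /s; ring.
  by rewrite ab mul1r; have := sqr_ge0 (a * y - b * x); lra.
have -> : (a - x) ^+ 2 + (b - y) ^+ 2 = (a ^+ 2 + b ^+ 2) - 2 * c + s.
  by rewrite /c /s; ring.
rewrite ab.
have : `|c| <= rho.
  by rewrite -(@ler_pXn2r _ 2)// ?nnegrE// real_normK ?num_real//; lra.
rewrite ler_norml => /andP[c1 c2].
have e1 : (1 + rho) ^+ 2 = 1 + 2 * rho + rho ^+ 2 by ring.
apply/andP; split; last by rewrite e1; lra.
have h : (1 - rho) ^+ 2 <= (1 - c) ^+ 2 by rewrite lerXn2r// ?nnegrE; lra.
apply: (le_trans h).
have -> : (1 - c) ^+ 2 = 1 - 2 * c + c ^+ 2 by ring.
lra.
Qed.

Lemma pois_ge0 (R : realType) (z p : R * R) :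
  sqnorm z = 1 -> sqnorm p <= 1 -> 0 <= pois z p.
Proof.
move=> z1 p1; rewrite /pois z1 divr_ge0//; first by rewrite subr_ge0.
by rewrite addr_ge0// sqr_ge0.
Qed.

Definition nodes (R : realType) (rs : seq (R * R)) : Prop :=
  (0 < size rs)%N /\ (forall z, z \in rs -> sqnorm z = 1).

Definition pmean (R : realType) (rs : seq (R * R)) (f : R * R -> R) (p : R * R) : R :=
  (size rs)%:R^-1 * \sum_(z <- rs) f z * pois z p.

Lemma pmean_le (R : realType) (rs : seq (R * R)) (f g : R * R -> R) (p q : R * R)
    (a b : R) : 
  (forall z, z \in rs -> a * (f z * pois z p) <= b * (g z * pois z q)) ->
  a * pmean rs f p <= b * pmean rs g q.
Proof.
move=> H; rewrite /pmean mulrCA [b * _]mulrCA ler_wpM2l ?invr_ge0//.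
by rewrite !mulr_sumr !big_seq; apply: ler_sum.
Qed.

(** The mean of Poisson kernels is harmonic, and it is close to f on a circle
    of radius close to 1, where a kernel has nearly all its mass near its pole;
    the maximum principle carries the closeness inside. *)
Lemma poisson_approx (R : realType) (f : R * R -> R) (rho0 eps : R) :
  (forall p, disc 1 p -> {for p, continuous f}) ->
  (forall p, sqnorm p < 1 -> harm f p) ->
  0 < rho0 -> rho0 < 1 -> 0 < eps ->
  exists2 rs : seq (R * R), nodes rs &
    forall p, disc rho0 p -> `|f p - pmean rs f p| <= eps.
Proof.
move=> cf hf r0 r1 e0.
have cD := @compact_disc R 1 ler01.
have [M M0 HM] := compact_bounded_fun cD cf.
have e40 : 0 < eps / 4 by lra.
have [d d0 Hd] := uniform_continuity cD cf e40.
(* On the circle of radius 1 - t, poles at distance at least d contribute at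
   most 4 (M + 1) t / d^2, which this t makes at most eps / 4. *)
pose t := Num.min (1 - rho0) (eps * d ^+ 2 / (16 * (M + 1))).
have t0 : 0 < t.
  rewrite lt_min subr_gt0 r1 /= divr_gt0 ?mulr_gt0// ?exprn_gt0//; lra.
have t1 : t <= 1 - rho0 by rewrite ge_min lexx.
have t2 : t * (16 * (M + 1)) <= eps * d ^+ 2.
  by rewrite -ler_pdivlMr; [rewrite ge_min lexx orbT|lra].
have {}t1 : rho0 <= 1 - t by lra.
set rho := 1 - t in t1.
have rho0' : 0 < rho by lra.
have rho1 : rho < 1 by rewrite /rho; lra.
have tt : 1 - rho ^+ 2 <= 2 * t.
  rewrite /rho; have := sqr_ge0 t.
  have -> : (1 - t) ^+ 2 = 1 - 2 * t + t ^+ 2 by ring.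
  lra.
(* e1 is the deviation of the mean kernel from 1, to be multiplied by M. *)
pose e1 := Num.min 1 (eps / (4 * (M + 1))).
have e10 : 0 < e1 by rewrite lt_min ltr01 divr_gt0//; lra.
have e11 : e1 <= 1 by rewrite ge_min lexx.
have e12 : e1 * (4 * (M + 1)) <= eps.
  by rewrite -ler_pdivlMr; [rewrite ge_min lexx orbT|lra].
have [rs [s0 rs1] Hrs] := poisson_nodes rho0' rho1 e10.
exists rs; first by split.
set N := (size rs)%:R : R.
have N0 : 0 < N by rewrite ltr0n.
have dpos z p : z \in rs -> disc rho p -> 0 < sqdist z p.
  move=> /rs1 z1 Dp; have /andP[+ _] := sqdist_circle z1 (ltW rho0') (ltW rho1) Dp.
  by apply: lt_le_trans; rewrite exprn_gt0// subr_gt0.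
have cp p : disc rho p -> {for p, continuous (pmean rs f)}.
  move=> Dp; rewrite /pmean; apply: cvgMl_tmp.
  suff H : forall s, {subset s <= rs} ->
      (fun q => \sum_(z <- s) f z * pois z q) @ p --> \sum_(z <- s) f z * pois z p.
    exact: H.
  elim=> [_|z s IH sub].
    by under eq_fun do rewrite big_nil; rewrite big_nil; exact: cvg_cst.
  under eq_fun do rewrite big_cons; rewrite big_cons; apply: cvgD.
    apply: cvgMl_tmp; apply: continuous_pois.
    by rewrite gt_eqF// dpos// sub// mem_head.
  by apply: IH => w ws; apply: sub; rewrite inE ws orbT.
have hp p : disc rho p -> harm (pmean rs f) p.
  move=> Dp; apply: harmZ.
  suff H : forall s, {subset s <= rs} ->
      harm (fun q => \sum_(z <- s) f z * pois z q) p by apply: H.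
  elim=> [_|z s IH sub]; first by under eq_fun do rewrite big_nil; exact: harm_cst.
  under eq_fun do rewrite big_cons; apply: harmD.
    apply: harmZ; apply: harm_pois.
    apply: contraTneq (dpos z p (sub _ (mem_head _ _)) Dp) => ->.
    by rewrite /sqdist !subrr expr0n /= addr0 ltxx.
  by apply: IH => w ws; apply: sub; rewrite inE ws orbT.
have bd p : sqnorm p = rho ^+ 2 -> `|f p - pmean rs f p| <= eps.
  move=> pr; have Dp : disc rho p by rewrite /disc /= pr.
  have D1 : disc 1 p := disc_sub (ltW rho0') (ltW rho1) Dp.
  have := Hrs p; rewrite pr lexx => /(_ isT).
  set m := N^-1 * _ => m1.
  have E : f p - pmean rs f p = N^-1 * (\sum_(z <- rs) (f p - f z) * pois z p) + f p * (1 - m).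
    rewrite /pmean -/N /m.
    under [in RHS]eq_bigr do rewrite mulrBl.
    by rewrite sumrB -mulr_sumr; ring.
  rewrite E; apply: le_trans (ler_normD _ _) _.
  have b2 : `|f p * (1 - m)| <= eps / 4.
    rewrite normrM distrC.
    apply: (@le_trans _ _ ((M + 1) * e1)); last by lra.
    by apply: ler_pM => //; apply: le_trans (HM p D1) _; lra.
  have b1 : `|N^-1 * (\sum_(z <- rs) (f p - f z) * pois z p)| <= eps / 4 * m + eps / 4.
    rewrite normrM gtr0_norm ?invr_gt0//.
    rewrite -(ler_pM2l N0) mulrA divff ?gt_eqF// mul1r.
    apply: le_trans (ler_norm_sum _ _ _) _.
    have -> : N * (eps / 4 * m + eps / 4) = \sum_(z <- rs) (eps / 4 * pois z p + eps / 4).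
      rewrite big_split /= -mulr_sumr big_const_seq count_predT iter_addr_0.
      by rewrite /m -[_ *+ _]mulr_natr -/N; field; rewrite gt_eqF.
    rewrite !big_seq; apply: ler_sum => z zr.
    have z1 := rs1 z zr.
    have D1z : disc 1 z by rewrite /disc /= z1 expr1n.
    have p0 : 0 <= pois z p.
      by apply: pois_ge0 => //; move: D1; rewrite /disc /= expr1n.
    rewrite normrM [X in _ * X]ger0_norm//.
    have [dzp|dzp] := ltP (sqdist z p) (d ^+ 2).
      have h := Hd z p D1z dzp.
      by have := ler_wpM2r p0 h; lra.
    have ep : 0 <= eps / 4 * pois z p by rewrite mulr_ge0//; lra.
    suff : `|f p - f z| * pois z p <= eps / 4 by lra.
    apply: (@le_trans _ _ (2 * (M + 1) * (2 * t / d ^+ 2))); last first.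
      rewrite mulrA ler_pdivrMr ?exprn_gt0//.
      have -> : eps / 4 * d ^+ 2 = (eps * d ^+ 2) / 4 by ring.
      by move: t2; set v := eps * _; lra.
    apply: ler_pM => //.
      apply: le_trans (ler_normB _ _) _.
      by have := HM p D1; have := HM z D1z; lra.
    rewrite /pois -/(sqdist z p) z1 pr ler_pM//.
    - by rewrite subr_ge0 -(expr1n _ 2) lerXn2r ?nnegrE//; lra.
    - by rewrite invr_ge0 ltW// dpos.
    - by rewrite lef_pV2 ?posrE ?exprn_gt0// dpos.
  apply: le_trans (lerD b1 b2) _.
  have m2 : m <= 2 by move: m1; rewrite ler_norml => /andP[_]; lra.
  have : eps / 4 * m <= eps / 4 * 2 by rewrite ler_wpM2l//; lra.
  lra.
move=> p Dp; have {}Dp : disc rho p := disc_sub (ltW r0) t1 Dp.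
have cDr := @compact_disc R rho (ltW rho0').
have hfp q : sqnorm q < rho ^+ 2 -> harm f q.
  move=> qr; apply: hf; apply: lt_le_trans qr _.
  by rewrite -(expr1n _ 2) lerXn2r ?nnegrE//; lra.
have cfp q : disc rho q -> {for q, continuous f}.
  by move=> Dq; exact: cf (disc_sub (ltW rho0') (ltW rho1) Dq).
have side (q : R * R) : disc rho q -> sqnorm q = rho ^+ 2 \/ sqnorm q < rho ^+ 2.
  by rewrite /disc /= le_eqVlt => /orP[/eqP|]; [left|right].
rewrite ler_norml; apply/andP; split.
  have H : pmean rs f p - f p - eps <= 0; last by lra.
  apply: (max_principle (f := fun q => pmean rs f q - f q - eps) cDr) => // q Dq.
    apply: cvgB; last exact: cvg_cst.
    by apply: cvgB; [exact: cp|exact: cfp].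
  have [qr|qr] := side q Dq.
    by left; have := bd q qr; rewrite ler_norml => /andP[]; lra.
  right; split; first exact: nbhs_disc.
  apply: (proj1 (harmB (harmB (hp _ Dq) (hfp _ qr)) (harm_cst _ _))).
have H : f p - pmean rs f p - eps <= 0; last by lra.
apply: (max_principle (f := fun q => f q - pmean rs f q - eps) cDr) => // q Dq.
  apply: cvgB; last exact: cvg_cst.
  by apply: cvgB; [exact: cfp|exact: cp].
have [qr|qr] := side q Dq.
  by left; have := bd q qr; rewrite ler_norml => /andP[]; lra.
right; split; first exact: nbhs_disc.
apply: (proj1 (harmB (harmB (hfp _ qr) (hp _ Dq)) (harm_cst _ _))).
Qed.

(** * Consequences for harmonic functions on the unit disc *)

Definition harm_on (R : realType) (A : set (R * R)) (f : R * R -> R) : Prop :=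
  forall p, A p -> {for p, continuous f} /\ harm f p.

Lemma harm_on_approx (R : realType) (f : R * R -> R) (rho eps : R) :
  harm_on (disc 1) f -> 0 < rho -> rho < 1 -> 0 < eps ->
  exists2 rs : seq (R * R), nodes rs &
    forall p, disc rho p -> `|f p - pmean rs f p| <= eps.
Proof.
move=> hf; apply: poisson_approx => p Dp; first by have [] := hf p Dp.
by have [] := hf p; rewrite // /disc /= expr1n ltW.
Qed.

Lemma le_of_eps (R : realType) (a b k : R) : 0 < k ->
  (forall e, 0 < e -> a <= b + k * e) -> a <= b.
Proof.
move=> k0 H; rewrite leNgt; apply/negP => ba.
have e0 : 0 < (a - b) / (2 * k) by rewrite divr_gt0; lra.
have := H _ e0; have -> : k * ((a - b) / (2 * k)) = (a - b) / 2.
  by field; rewrite gt_eqF.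
lra.
Qed.

(** The Poisson kernel at p is at most (1 - r)^-2, while it is 1 at the
    centre; positivity of f lets the comparison pass to the averages. *)
Lemma harnack (R : realType) (f : R * R -> R) (r : R) (p : R * R) :
  harm_on (disc 1) f -> (forall q, disc 1 q -> 0 <= f q) ->
  0 < r -> r < 1 -> disc r p -> (1 - r) ^+ 2 * f p <= f (0, 0).
Proof.
move=> hf f0 r0 r1 Dp.
apply: (@le_of_eps _ _ _ 2) => // e e0.
have [rs [_ rs1] H] := harm_on_approx hf r0 r1 e0.
have r2 : 0 <= (1 - r) ^+ 2 by exact: sqr_ge0.
have r21 : (1 - r) ^+ 2 <= 1.
  by rewrite -[X in _ <= X](expr1n _ 2) lerXn2r// ?nnegrE; lra.
have s1 : sqnorm p <= 1.
  by apply: le_trans Dp _; rewrite -[X in _ <= X](expr1n _ 2) lerXn2r// ?nnegrE; lra.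
have D0 : disc r (0, 0) by rewrite /disc /sqnorm /= expr0n /= addr0 sqr_ge0.
have M : (1 - r) ^+ 2 * pmean rs f p <= 1 * pmean rs f (0, 0).
  apply: pmean_le => z /rs1 z1; rewrite mul1r mulrCA ler_wpM2l//.
    by apply: f0; rewrite /disc /= z1 expr1n.
  have /andP[dz _] := sqdist_circle z1 (ltW r0) (ltW r1) Dp.
  have r3 : 0 < (1 - r) ^+ 2 by rewrite exprn_gt0; lra.
  have -> : pois z (0, 0) = 1.
    rewrite /pois !subr0 /= -/(sqnorm z) z1 /sqnorm /= expr0n /= addr0 subr0.
    by rewrite divr1.
  rewrite /pois -/(sqdist z p) z1 mulrA ler_pdivrMr; last by apply: lt_le_trans dz.
  rewrite mul1r; apply: le_trans dz; rewrite ler_piMr//.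
  by rewrite gerBl addr_ge0// sqr_ge0.
have := H p Dp; have := H _ D0; rewrite !ler_norml => /andP[h1 _] /andP[_ h3].
have h4 : (1 - r) ^+ 2 * f p <= (1 - r) ^+ 2 * (pmean rs f p + e).
  by rewrite ler_wpM2l//; lra.
have h5 : (1 - r) ^+ 2 * e <= e by rewrite ler_piMl// ltW.
move: M h4; rewrite mul1r mulrDr; lra.
Qed.

Definition mirror (R : realType) (p : R * R) : R * R := (- p.1, p.2).

Lemma sqnorm_mirror (R : realType) (p : R * R) : sqnorm (mirror p) = sqnorm p.
Proof. by rewrite /sqnorm /= sqrrN. Qed.

Lemma continuous_mirror (R : realType) : continuous (@mirror R).
Proof.
move=> p; apply: (@cvg_pair _ _ _ (nbhs p) (nbhs (- p.1)) (nbhs p.2)).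
  by apply: cvgN; exact: cvg_fst.
exact: cvg_snd.
Qed.

Lemma pois_mirrorB (R : realType) (z p : R * R) : sqdist z p != 0 ->
  sqdist z (mirror p) != 0 ->
  pois z p - pois z (mirror p) =
  4 * (sqnorm z - sqnorm p) * (z.1 * p.1) / (sqdist z p * sqdist z (mirror p)).
Proof.
rewrite /pois -!/(sqdist z _) sqnorm_mirror => d1 d2.
rewrite -mulrBr -mulrA -!mulrA.
have -> : (sqdist z p)^-1 - (sqdist z (mirror p))^-1 =
   (sqdist z (mirror p) - sqdist z p) / (sqdist z p * sqdist z (mirror p)).
  by field; rewrite d1 d2.
have -> : sqdist z (mirror p) - sqdist z p = 4 * (z.1 * p.1).
  by rewrite /sqdist /=; ring.
ring.
Qed.

(** For an odd function the kernel may be replaced by its odd part, which is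
    x times the abscissa of the pole times a factor bounded above and below.
    The bounds 2 * 10^4 at p and 2 (3 / 4) (16 / 81) at (x0, 0) of that factor
    have a ratio below 10^5. *)
Lemma boundary_harnack (R : realType) (v : R * R -> R) (p : R * R) (x0 : R) :
  harm_on (disc 1) v -> (forall q, v (mirror q) = - v q) ->
  (forall q, disc 1 q -> 0 <= q.1 -> 0 <= v q) ->
  disc (9 / 10) p -> 0 <= p.1 -> 0 < x0 -> x0 <= 1 / 2 ->
  x0 * v p <= 10 ^+ 5 * p.1 * v (x0, 0).
Proof.
move=> hv odd v0 Dp p0 x00 x01.
have r0 : 0 < 9 / 10 :> R by lra.
have r1 : 9 / 10 < 1 :> R by lra.
set K := 10 ^+ 5; have K0 : 0 <= K by rewrite exprn_ge0.
have k0 : 0 < x0 + K * p.1 by rewrite ltr_wpDr// mulr_ge0.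
apply: (le_of_eps k0) => e e0.
have [rs [_ rs1] H] := harm_on_approx hv r0 r1 e0.
pose k (z q : R * R) := 2^-1 * (pois z q - pois z (mirror q)).
pose m q := (size rs)%:R^-1 * \sum_(z <- rs) v z * k z q.
have Hm q : disc (9 / 10) q -> `|v q - m q| <= e.
  move=> Dq; have Dq' : disc (9 / 10) (mirror q) by rewrite /disc /= sqnorm_mirror.
  have -> : m q = 2^-1 * (pmean rs v q - pmean rs v (mirror q)).
    rewrite /m /pmean -mulrBr [RHS]mulrCA; congr (_ * _).
    rewrite -sumrB mulr_sumr.
    by apply: eq_bigr => z _; rewrite /k; ring.
  have := H q Dq; have := H _ Dq'; rewrite odd !ler_norml => /andP[h1 h2] /andP[h3 h4].
  by apply/andP; split; lra.
have Dx0 : disc (1 / 2) (x0, 0).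
  by rewrite /disc /sqnorm /= expr0n /= addr0 lerXn2r// ?nnegrE; lra.
have h12 : 0 <= 1 / 2 :> R by lra.
have M : x0 * m p <= K * p.1 * m (x0, 0).
  rewrite /m mulrCA [_ * (_^-1 * _)]mulrCA ler_wpM2l ?invr_ge0//.
  rewrite !mulr_sumr !big_seq; apply: ler_sum => z /rs1 z1.
  have /andP[d1 _] := sqdist_circle z1 (ltW r0) (ltW r1) Dp.
  have Dmp : disc (9 / 10) (mirror p) by rewrite /disc /= sqnorm_mirror.
  have /andP[d2 _] := sqdist_circle z1 (ltW r0) (ltW r1) Dmp.
  have /andP[d3 d3'] : (1 - 1 / 2) ^+ 2 <= sqdist z (x0, 0) <= (1 + 1 / 2) ^+ 2.
    by apply: sqdist_circle => //; lra.
  have /andP[d4 d4'] : (1 - 1 / 2) ^+ 2 <= sqdist z (mirror (x0, 0)) <= (1 + 1 / 2) ^+ 2.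
    by apply: sqdist_circle => //; [lra|rewrite /disc /= sqnorm_mirror].
  have t1 : (1 - 9 / 10) ^+ 2 = 1 / 100 :> R by field.
  have t2 : (1 - 1 / 2) ^+ 2 = 1 / 4 :> R by field.
  have t3 : (1 + 1 / 2) ^+ 2 = 9 / 4 :> R by field.
  rewrite t1 in d1 d2; rewrite t2 in d3 d4; rewrite t3 in d3' d4'.
  have sg : 0 <= v z * z.1.
    have D1 : disc 1 z by rewrite /disc /= z1 expr1n.
    have [zp|/ltW zn] := leP 0 z.1; first by rewrite mulr_ge0// v0.
    rewrite mulr_le0// -oppr_ge0 -odd v0 //= ?oppr_ge0//.
    by rewrite /disc /= sqnorm_mirror.
  have s1 : sqnorm p <= 1.
    by apply: le_trans Dp _; rewrite -[X in _ <= X](expr1n _ 2) lerXn2r// ?nnegrE; lra.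
  have s0 : 0 <= sqnorm p by rewrite addr_ge0// sqr_ge0.
  have s2 : sqnorm (x0, 0) <= 1 / 4.
    have t4 : (1 / 2) ^+ 2 = 1 / 4 :> R by field.
    by rewrite -t4.
  have pos : 0 < 1 / 100 :> R by lra.
  have pos4 : 0 < 1 / 4 :> R by lra.
  have nz1 := gt_eqF (lt_le_trans pos d1); have nz2 := gt_eqF (lt_le_trans pos d2).
  have nz3 := gt_eqF (lt_le_trans pos4 d3); have nz4 := gt_eqF (lt_le_trans pos4 d4).
  rewrite /k !pois_mirrorB ?nz1 ?nz2 ?nz3 ?nz4//.
  rewrite z1; set A := sqdist z p in d1 *; set B := sqdist z (mirror p) in d2 *.
  set C := sqdist z (x0, 0) in d3 d3' *; set D := sqdist z (mirror (x0, 0)) in d4 d4' *.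
  have -> : x0 * (v z * (2^-1 * (4 * (1 - sqnorm p) * (z.1 * p.1) / (A * B)))) =
     (v z * z.1 * p.1 * x0) * (2 * ((1 - sqnorm p) * (A * B)^-1)).
    by field; rewrite /A /B nz1 nz2.
  have -> : K * p.1 * (v z * (2^-1 * (4 * (1 - sqnorm (x0, 0)) * (z.1 * x0) / (C * D)))) =
     (v z * z.1 * p.1 * x0) * (2 * (K * ((1 - sqnorm (x0, 0)) * (C * D)^-1))).

    by field; rewrite /C /D nz3 nz4.
  apply: ler_wpM2l; first by apply: mulr_ge0; [exact: mulr_ge0|exact: ltW].
  apply: ler_wpM2l => //.
  have AB : 10 ^- 4 <= A * B.
    have -> : 10 ^- 4 = 1 / 100 * (1 / 100) :> R by field.
    by rewrite ler_pM//; lra.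
  have CD : C * D <= 81 / 16.
    have -> : 81 / 16 = 9 / 4 * (9 / 4) :> R by field.
    by rewrite ler_pM//; lra.
  have CD0 : 0 < C * D by rewrite mulr_gt0// (lt_le_trans pos4).
  apply: (@le_trans _ _ (10 ^+ 4)).
    rewrite ler_pdivrMr ?mulr_gt0// ?(lt_le_trans pos)//.
    have : 10 ^+ 4 * 10 ^- 4 <= 10 ^+ 4 * (A * B) by rewrite ler_wpM2l// exprn_ge0.
    by rewrite divff; [lra|rewrite expf_eq0 /= pnatr_eq0].
  rewrite mulrA ler_pdivlMr// /K [10 ^+ 5]exprSr.
  have pos5 : 0 <= 10 ^+ 4 :> R by rewrite exprn_ge0.
  by rewrite -[X in _ <= X]mulrA; apply: (ler_wpM2l pos5); lra.
have D2 : disc (9 / 10) (x0, 0) by apply: disc_sub Dx0; lra.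
have := Hm p Dp; have := Hm _ D2; rewrite !ler_norml => /andP[h1 h2] /andP[h3 h4].
have h5 : x0 * (v p) <= x0 * (m p + e) by rewrite ler_pM2l//; lra.
have h6 : K * p.1 * (m (x0, 0)) <= K * p.1 * (v (x0, 0) + e).
  by rewrite ler_wpM2l ?mulr_ge0//; lra.
move: h5 h6 M; rewrite !mulrDr [(x0 + _) * e]mulrDl; lra.
Qed.

(** With w = p / z on the unit circle of poles, the kernel is the real part of
    1 + 2 w + 2 w^2 + 2 w^3 / (1 - w), and |1 - w| >= 1 / 6. *)
Lemma pmean_quadratic (R : realType) (rs : seq (R * R)) (f : R * R -> R) (C : R) :
  nodes rs -> 0 <= C -> (forall z, sqnorm z = 1 -> `|f z| <= C) ->
  exists a : R, exists b c : R[i], forall p, disc (5 / 6) p ->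
    `|pmean rs f p - (a + complex.Re (b * toC p) + complex.Re (c * toC p ^+ 2))|
      <= 12 * C * modulus (toC p) ^+ 3.
Proof.
move=> [s0 rs1] C0 fC; set N := (size rs)%:R : R.
have N0 : 0 < N by rewrite ltr0n.
exists (N^-1 * \sum_(z <- rs) f z).
exists ((N^-1)%:C * \sum_(z <- rs) (f z)%:C * (2 / toC z)).
exists ((N^-1)%:C * \sum_(z <- rs) (f z)%:C * (2 / toC z ^+ 2)) => p Dp.
set q := toC p; set m := modulus q.
have m0 : 0 <= m by exact: modulus_ge0.
have mp : m <= 5 / 6.
  have h56 : 0 <= 5 / 6 :> R by lra.
  by rewrite -(@ler_pXn2r _ 2)// ?nnegrE// /m /q -sqnorm_toC.
have ReM (x : R) (w : R[i]) : complex.Re (x%:C * w) = x * complex.Re w.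
  by case: w => a b /=; ring.
have ReS (s : seq (R * R)) (g : R * R -> R[i]) :
    complex.Re (\sum_(z <- s) g z) = \sum_(z <- s) complex.Re (g z).
  by apply: (big_morph (@complex.Re R) (@ReD R) (erefl _)).
have E : pmean rs f p - (N^-1 * (\sum_(z <- rs) f z)
      + complex.Re ((N^-1)%:C * (\sum_(z <- rs) (f z)%:C * (2 / toC z)) * q)
      + complex.Re ((N^-1)%:C * (\sum_(z <- rs) (f z)%:C * (2 / toC z ^+ 2)) * q ^+ 2)) =
    N^-1 * \sum_(z <- rs) f z * (pois z p - 1 - complex.Re (2 / toC z * q)
       - complex.Re (2 / toC z ^+ 2 * q ^+ 2)).
  have sum3 (k b c : R * R -> R) : N^-1 * (\sum_(z <- rs) f z * k z)
      - (N^-1 * (\sum_(z <- rs) f z) + N^-1 * (\sum_(z <- rs) f z * b z)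
         + N^-1 * (\sum_(z <- rs) f z * c z))
      = N^-1 * \sum_(z <- rs) f z * (k z - 1 - b z - c z).
    under [in RHS]eq_bigr do rewrite !mulrBr mulr1.
    by rewrite !sumrB; ring.
  have Resum (g : R * R -> R[i]) (w : R[i]) :
      complex.Re ((N^-1)%:C * (\sum_(z <- rs) (f z)%:C * g z) * w) =
      N^-1 * \sum_(z <- rs) f z * complex.Re (g z * w).
    rewrite -mulrA ReM mulr_suml ReS; congr (_ * _).
    by apply: eq_bigr => z _; rewrite -mulrA ReM.
  by rewrite !Resum; exact: sum3.
rewrite E normrM gtr0_norm ?invr_gt0// -(ler_pM2l N0) mulrA divff ?gt_eqF// mul1r.
apply: le_trans (ler_norm_sum _ _ _) _.
have -> : N * (12 * C * m ^+ 3) = \sum_(z <- rs) 12 * C * m ^+ 3.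
  by rewrite big_const_seq count_predT iter_addr_0 -[RHS]mulr_natl.
rewrite !big_seq; apply: ler_sum => z /rs1 z1.
have mz : modulus (toC z) = 1.
  apply/eqP; rewrite -(@pexpr_eq1 _ _ 2)// ?modulus_ge0//.
  by rewrite -sqnorm_toC z1.
have z0 : toC z != 0 by rewrite -modulus_eq0 mz oner_eq0.
have d1 : 1 / 6 <= modulus (toC z - q).
  by apply: le_trans (modulusB _ _); rewrite mz -/m; lra.
have d0 : toC z - q != 0.
  by rewrite -modulus_eq0 gt_eqF//; apply: lt_le_trans d1; lra.
have -> : pois z p - 1 - complex.Re (2 / toC z * q)
       - complex.Re (2 / toC z ^+ 2 * q ^+ 2) =
    complex.Re (2 * q ^+ 3 / (toC z ^+ 2 * (toC z - q))).
  rewrite pois_toC -/q.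
  have -> : (toC z + q) / (toC z - q) = 1%:C + 2 / toC z * q
       + 2 / toC z ^+ 2 * q ^+ 2 + 2 * q ^+ 3 / (toC z ^+ 2 * (toC z - q)).
    by field; rewrite d0 z0.
  by rewrite !ReD /=; ring.
rewrite normrM.
have -> : 12 * C * m ^+ 3 = C * (12 * m ^+ 3) by ring.
apply: ler_pM => //; first exact: fC.
apply: le_trans (Re_le_modulus _) _.
rewrite !(modulusM, modulusV, modulusX) mz expr1n mul1r -/m.
have -> : modulus (2 : R[i]) = 2.
  have -> : (2 : R[i]) = (2 : R)%:C by rewrite rmorph_nat.
  by rewrite modulusC normr_nat.
rewrite ler_pdivrMr; last by apply: lt_le_trans d1; lra.
have m3 : 0 <= m ^+ 3 by rewrite exprn_ge0.
have : 12 * m ^+ 3 * (1 / 6) <= 12 * m ^+ 3 * modulus (toC z - q).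
  by apply: ler_wpM2l => //; rewrite mulr_ge0.
lra.
Qed.

(** Near the origin the value along the imaginary axis forces the constant,
    linear and quadratic coefficients of the Poisson expansion, up to the
    accuracy of the approximation; the linear coefficient in x vanishes by
    evenness. *)
Lemma even_cubic_remainder (R : realType) (f : R * R -> R) (C k : R) (p : R * R) :
  harm_on (disc 1) f -> (forall q, f (mirror q) = f q) ->
  (forall q, disc 1 q -> `|f q| <= C) ->
  (forall t, 0 < t -> exists2 d, 0 < d & forall y, `|y| < d ->
     `|f (0, y) - k * y ^+ 2| <= t * y ^+ 2) ->
  disc (5 / 6) p ->
  `|f p + k * (p.1 ^+ 2 - p.2 ^+ 2)| <= 12 * C * modulus (toC p) ^+ 3.
Proof.
move=> hf even fC f2 Dp.
have C0 : 0 <= C.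
  by apply: le_trans (fC (0, 0) _); rewrite // /disc /sqnorm /= expr0n /= addr0 expr1n.
have quad e : 0 < e -> exists a b c : R, forall q, disc (5 / 6) q ->
    `|f q - (a + b * q.2 + c * (q.1 ^+ 2 - q.2 ^+ 2))|
       <= e + 12 * C * modulus (toC q) ^+ 3.
  move=> e0; have [|||rs nrs H] := @harm_on_approx _ f (5 / 6) e hf => //; try by lra.
  have [|a [b [c Q]]] := @pmean_quadratic _ rs f C nrs C0.
    by move=> z z1; apply: fC; rewrite /disc /= z1 expr1n.
  exists a, (- complex.Im b), (complex.Re c) => q Dq.
  have Dm : disc (5 / 6) (mirror q) by rewrite /disc /= sqnorm_mirror.
  have mm : modulus (toC (mirror q)) = modulus (toC q).
    by rewrite !modulusE /= sqrrN.
  have := H q Dq; have := H _ Dm; have := Q q Dq; have := Q _ Dm.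
  rewrite mm even !ler_norml; set M := 12 * _ * _.
  have -> : complex.Re (b * toC (mirror q)) =
      - (complex.Re b * q.1) - complex.Im b * q.2.
    by case: b {Q} => b1 b2 /=; ring.
  have -> : complex.Re (c * toC (mirror q) ^+ 2) =
      complex.Re c * (q.1 ^+ 2 - q.2 ^+ 2) + 2 * (complex.Im c * q.1 * q.2).
    by case: c {Q} => c1 c2 /=; ring.
  have -> : complex.Re (b * toC q) = complex.Re b * q.1 - complex.Im b * q.2.
    by case: b {Q} => b1 b2 /=; ring.
  have -> : complex.Re (c * toC q ^+ 2) =
      complex.Re c * (q.1 ^+ 2 - q.2 ^+ 2) - 2 * (complex.Im c * q.1 * q.2).
    by case: c {Q} => c1 c2 /=; ring.
  move=> /andP[? ?] /andP[? ?] /andP[? ?] /andP[? ?]; apply/andP; split; lra.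
have f00 : f (0, 0) = 0.
  have [d d0 /(_ 0)] := f2 1 ltr01.
  by rewrite normr0 expr0n /= !mulr0 subr0 normr_le0 => /(_ d0)/eqP.
have x20 : 0 <= p.1 ^+ 2 by exact: sqr_ge0.
have y20 : 0 <= p.2 ^+ 2 by exact: sqr_ge0.
have K0 : 0 < 20 + 20 * (p.1 ^+ 2 + p.2 ^+ 2) by lra.
apply: (@le_of_eps _ _ _ (20 + 20 * (p.1 ^+ 2 + p.2 ^+ 2))) => // t t0.
have [d d0 fd] := f2 t t0.
(* At height y the cubic remainder is at most t y^2, so that the accuracy
   t y^2 determines the coefficients b and c up to multiples of t. *)
pose y := Num.min (Num.min (d / 2) (5 / 6)) (t / (12 * C + 1)).
have y0 : 0 < y by rewrite !lt_min !divr_gt0//; lra.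
have yd : y < d by apply: (@le_lt_trans _ _ (d / 2)); [rewrite !ge_min lexx|lra].
have y1 : y <= 5 / 6 by rewrite !ge_min lexx orbT.
have yt : 12 * C * y <= t.
  have : y <= t / (12 * C + 1) by rewrite !ge_min lexx !orbT.
  rewrite ler_pdivlMr; last by lra.
  by rewrite mulrDr mulr1 [y * _]mulrC; lra.
have yy0 : 0 < y ^+ 2 by rewrite exprn_gt0.
have e0 : 0 < Num.min t (t * y ^+ 2) by rewrite lt_min t0 mulr_gt0.
have [a [b [c Q]]] := quad _ e0.
set e := Num.min _ _ in e0 Q.
have et : e <= t by rewrite ge_min lexx.
have ety : e <= t * y ^+ 2 by rewrite ge_min lexx orbT.
have D0 : disc (5 / 6 : R) (0, 0) by rewrite /disc /sqnorm /= expr0n /= addr0 sqr_ge0.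
have Dy s : `|s| = y -> disc (5 / 6) (0, s).
  move=> sy; rewrite /disc /sqnorm /= expr0n /= add0r -real_normK ?num_real// sy.
  by rewrite lerXn2r// ?nnegrE; lra.
have my s : modulus (toC (0, s)) = `|s|.
  by rewrite modulusE /= expr0n /= add0r sqrtr_sqr.
have yb s : `|s| = y -> `|k * s ^+ 2 - (a + b * s - c * s ^+ 2)| <= 3 * t * y ^+ 2.
  move=> sy; have := Q _ (Dy s sy); have := fd s; rewrite sy my sy => /(_ yd) /=.
  have s2 : s ^+ 2 = y ^+ 2 by rewrite -real_normK ?num_real// sy.
  rewrite expr0n /= sub0r s2.
  have : 12 * C * y ^+ 3 <= t * y ^+ 2.
    have -> : 12 * C * y ^+ 3 = 12 * C * y * y ^+ 2 by ring.
    by apply: ler_wpM2r => //; exact: ltW.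
  rewrite !ler_norml => ? /andP[? ?] /andP[? ?]; apply/andP; split; lra.
have a0 : `|a| <= t * y ^+ 2.
  have := Q _ D0; rewrite f00 my normr0 /= !expr0n /= subr0 !mulr0 !addr0 sub0r normrN.
  by move/le_trans; apply.
have bb : `|b| * y <= 3 * t * y ^+ 2.
  have := yb y (gtr0_norm y0); have := yb (- y); rewrite normrN gtr0_norm// => /(_ erefl).
  rewrite sqrrN -[X in `|b| * X](gtr0_norm y0) -normrM !ler_norml.
  by move=> /andP[? ?] /andP[? ?]; apply/andP; split; lra.
have cc : `|k + c| * y ^+ 2 <= 4 * t * y ^+ 2.
  have := yb y (gtr0_norm y0); have := yb (- y); rewrite normrN gtr0_norm// => /(_ erefl).
  rewrite sqrrN -[X in `|k + c| * X](gtr0_norm yy0) -normrM.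
  move: a0; rewrite !ler_norml.
  by move=> /andP[? ?] /andP[? ?] /andP[? ?]; apply/andP; split; lra.
have {}bb : `|b| <= 3 * t.
  rewrite -(ler_pM2r y0); apply: le_trans bb _; rewrite expr2 mulrA ler_piMr//.
    by rewrite !mulr_ge0// ltW.
  lra.
have {}cc : `|k + c| <= 4 * t by rewrite -(ler_pM2r yy0).
have {}a0 : `|a| <= t.
  apply: le_trans a0 _; rewrite ler_piMr// ?ltW//.
  by rewrite -(expr1n _ 2) ltr_pXn2r// ?nnegrE ?ltW//; lra.
have := Q _ Dp; set M := 12 * _ * _ => Qp.
have E : f p + k * (p.1 ^+ 2 - p.2 ^+ 2) =
   (f p - (a + b * p.2 + c * (p.1 ^+ 2 - p.2 ^+ 2))) + a + b * p.2
     + (k + c) * (p.1 ^+ 2 - p.2 ^+ 2) by ring.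
rewrite E.
have p2 : `|p.2| <= 1.
  rewrite -(@ler_pXn2r _ 2)// ?nnegrE// expr1n real_normK ?num_real//.
  move: Dp; rewrite /disc /sqnorm /=.
  have -> : (5 / 6) ^+ 2 = 25 / 36 :> R by field.
  lra.
have h1 : `|b * p.2| <= 3 * t.
  by rewrite normrM -[X in _ <= X]mulr1 ler_pM.
have h2 : `|(k + c) * (p.1 ^+ 2 - p.2 ^+ 2)| <= 4 * t * (p.1 ^+ 2 + p.2 ^+ 2).
  rewrite normrM ler_pM//; rewrite ler_norml; apply/andP; split; lra.
have tp : 0 <= t * (p.1 ^+ 2 + p.2 ^+ 2) by rewrite mulr_ge0 ?addr_ge0// ltW.
apply: le_trans (ler_normD _ _) _; apply: le_trans (lerD (ler_normD _ _) h2) _.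
have := ler_normD (f p - (a + b * p.2 + c * (p.1 ^+ 2 - p.2 ^+ 2))) a.
have -> : (20 + 20 * (p.1 ^+ 2 + p.2 ^+ 2)) * t = 20 * t + 20 * (t * (p.1 ^+ 2 + p.2 ^+ 2)) by ring.
have -> : 4 * t * (p.1 ^+ 2 + p.2 ^+ 2) = 4 * (t * (p.1 ^+ 2 + p.2 ^+ 2)) by ring.
move: tp; set u := t * _; move: Qp; set w := `|f p - _|; lra.
Qed.

(** * Second differences of functions of one variable *)

Definition sdiff (R : realType) (g : R -> R) (y h : R) : R :=
  g (y + h) + g (y - h) - 2 * g y.

Definition subsdiff (R : realType) (g : R -> R) (y : R) : Prop :=
  forall e : R, 0 < e -> \forall h \near (0 : R)^'+, - (e * h ^+ 2) <= sdiff g y h.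

(** As in max_principle, adding a small multiple of y^2 makes the second
    difference positive, which excludes an interior maximum. *)
Lemma subsdiff_max (R : realType) (a b : R) (g : R -> R) :
  a < b -> {within `[a, b], continuous g} ->
  (forall y, a < y < b -> subsdiff g y) -> g a <= 0 -> g b <= 0 ->
  forall y, a <= y <= b -> g y <= 0.
Proof.
move=> ab cg sg ga gb y0 y0ab; rewrite leNgt; apply/negP => gy0.
pose M := a ^+ 2 + b ^+ 2.
have M0 : 0 <= M by rewrite addr_ge0// sqr_ge0.
have yM y : a <= y <= b -> y ^+ 2 <= M.
  move=> /andP[ay yb]; have [y1|y1] := leP 0 y.
    have : y ^+ 2 <= b ^+ 2 by rewrite lerXn2r// nnegrE; lra.
    by have := sqr_ge0 a; rewrite /M; lra.
  have : (- y) ^+ 2 <= (- a) ^+ 2 by rewrite lerXn2r// ?nnegrE; lra.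
  by rewrite !sqrrN; have := sqr_ge0 b; rewrite /M; lra.
pose d := g y0 / (M + 1).
have d0 : 0 < d by rewrite divr_gt0//; lra.
have dM : d * M < g y0.
  by rewrite /d mulrAC ltr_pdivrMr; [rewrite ltr_pM2l//|]; lra.
have cg2 : {within `[a, b], continuous (fun y => g y + d * y ^+ 2)}.
  apply: within_continuousD => //.
  apply: continuous_subspaceT => y; apply: cvgMl_tmp.
  by apply: cvgM; exact: cvg_id.
have [q qab qmax] := EVT_max (ltW ab) cg2.
have H0 : g y0 <= g q + d * q ^+ 2.
  have := qmax y0; rewrite in_itv /= y0ab => /(_ isT); apply: le_trans.
  by rewrite lerDl mulr_ge0 ?sqr_ge0// ltW.
rewrite in_itv /= in qab.
have dqM : d * q ^+ 2 <= d * M by rewrite ler_pM2l// yM.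
have gq : 0 < g q by lra.
have aq : a < q.
  rewrite lt_neqAle; case/andP: qab => -> _; rewrite andbT.
  by apply: contraTneq gq => <-; rewrite -leNgt.
have qb : q < b.
  rewrite lt_neqAle; case/andP: qab => _ ->; rewrite andbT.
  by apply: contraTneq gq => ->; rewrite -leNgt.
have aqb : a < q < b by rewrite aq.
have h1 : 0 < q - a by lra.
have h2 : 0 < b - q by lra.
have := filter_ex (filterI (nbhs_right_gt (0 : R)) (filterI (sg q aqb d d0)
  (filterI (nbhs_right_lt h1) (nbhs_right_lt h2)))).
move=> [h [h0 [hs [ha hb]]]]; move: hs; rewrite /sdiff.
have := qmax (q + h); have := qmax (q - h); rewrite !in_itv /=.
have -> : a <= q - h <= b by apply/andP; split; lra.
have -> : a <= q + h <= b by apply/andP; split; lra.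
move=> /(_ isT) + /(_ isT).
have dh : 0 < d * h ^+ 2 by rewrite mulr_gt0// exprn_gt0.
have -> : d * (q + h) ^+ 2 = d * q ^+ 2 + 2 * (d * (q * h)) + d * h ^+ 2 by ring.
have -> : d * (q - h) ^+ 2 = d * q ^+ 2 - 2 * (d * (q * h)) + d * h ^+ 2 by ring.
move: dh; set s := d * h ^+ 2; set t := d * (q * h); set c := d * _.
lra.
Qed.

(** A convex function lies below its chord from 0 to Y; a negative value at Y
    would make it at most - c y near 0. *)
Lemma subsdiff_ge0 (R : realType) (Y K : R) (g : R -> R) :
  0 < Y -> {within `[0, Y], continuous g} ->
  (forall y, 0 < y < Y -> subsdiff g y) -> g 0 = 0 ->
  (\forall y \near (0 : R)^'+, - (K * y ^+ 2) <= g y) -> 0 <= g Y.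
Proof.
move=> Y0 cg sg g0 gK; rewrite leNgt; apply/negP => gY.
have ch y : 0 <= y <= Y -> g y - g Y / Y * y <= 0.
  apply: (subsdiff_max (g := fun y => g y - g Y / Y * y) Y0).
  - apply: within_continuousB => //.
    by apply: continuous_subspaceT => x; apply: cvgMl_tmp; exact: cvg_id.
  - move=> x xY e e0; move: (sg x xY e e0); apply: filterS => h.
    by rewrite /sdiff; lra.
  - by rewrite g0 mulr0 subr0.
  - by rewrite divfK ?gt_eqF// subrr.
pose c := - (g Y / Y).
have c0 : 0 < c by rewrite oppr_gt0 pmulr_llt0// invr_gt0.
pose z := c / (`|K| + 1).
have z0 : 0 < z by rewrite divr_gt0// ltr_wpDl.
have := filter_ex (filterI (nbhs_right_gt (0 : R)) (filterI gK
  (filterI (nbhs_right_lt z0) (nbhs_right_lt Y0)))).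
move=> [y [y0 [gy [yz yY]]]].
have := ch y; rewrite (ltW y0) (ltW yY) => /(_ isT) H.
have Ky : K * y < c.
  move: yz; rewrite /z ltr_pdivlMr ?ltr_wpDl// mulrDr mulr1.
  have : K * y <= `|K| * y by rewrite ler_wpM2r ?ler_norm// ltW.
  by rewrite [y * _]mulrC; lra.
have : K * y * y < c * y by rewrite ltr_pM2r.
have -> : K * y * y = K * y ^+ 2 by ring.
by move: H gy; rewrite /c mulNr; set t := K * _; set s := _ * y; lra.
Qed.

(** * Even ridge functions: monotonicity in the distance to the axis *)

(** The even extension of u after scaling to a strip of half-width 1.
    er_taylor is the normalization at the origin, stated without derivatives;
    in er_growth the rate 1 / 2 only has to be smaller than the rate 1 of the
    barrier below. *)
Record even_ridge (R : realType) (F : R * R -> R) : Prop := EvenRidge {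
  er_harm : harm_on [set p | `|p.1| < 1] F;
  er_even : forall p, F (mirror p) = F p;
  er_ridge : forall p, `|p.1| < 1 -> F p <= F (0, p.2);
  er_taylor : forall t, 0 < t -> exists2 d, 0 < d & forall y, `|y| < d ->
    `|F (0, y) - 2^-1 * y ^+ 2| <= t * y ^+ 2;
  er_growth : forall N, exists2 r, N <= r &
    F (0, r) <= expR (r / 2) /\ F (0, - r) <= expR (r / 2) }.

(** On the axis, harmonicity exchanges the second difference in y for the
    defect F (0, y) - F (h, y) in x, which the ridge property makes
    nonnegative. *)
Lemma cross_sum_axis (R : realType) (F : R * R -> R) (y h : R) :
  (forall p, F (mirror p) = F p) ->
  cross_sum F (0, y) h =
  sdiff (fun t => F (0, t)) y h - 2 * (F (0, y) - F (h, y)).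
Proof.
move=> even; rewrite /cross_sum /sdiff /= add0r sub0r.
by rewrite -(even (- h, y)) /mirror /= opprK; ring.
Qed.

Lemma continuous_axis (R : realType) (F : R * R -> R) (y : R) :
  {for (0, y), continuous F} -> {for y, continuous (fun t => F (0, t))}.
Proof.
move=> cF.
have H : (fun t : R => (0 : R, t)) @ y --> ((0 : R), y).
  apply: (@cvg_pair _ _ _ (nbhs y) (nbhs (0 : R)) (nbhs y)); first exact: cvg_cst.
  exact: cvg_id.
exact: (cvg_comp _ _ H cF).
Qed.

Lemma er_cont_axis (R : realType) (F : R * R -> R) : even_ridge F ->
  continuous (fun t => F (0, t)).
Proof.
move=> H y; apply: continuous_axis.
have D : `|((0 : R), y).1| < 1 by rewrite normr0.
by have [] := er_harm H D.
Qed.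

Lemma er_subsdiff (R : realType) (F : R * R -> R) (y : R) : even_ridge F ->
  subsdiff (fun t => F (0, t)) y.
Proof.
move=> H e e0.
have D : `|((0 : R), y).1| < 1 by rewrite normr0.
have [_ [sF _]] := er_harm H D.
near=> h.
have h0 : 0 < h by [].
have h1 : h < 1 by near: h; exact: nbhs_right_lt.
have : - (e * h ^+ 2) <= cross_sum F (0, y) h by near: h; exact: sF.
rewrite (cross_sum_axis _ _ (er_even H)).
have := er_ridge H (p := (h, y)); rewrite /= gtr0_norm// => /(_ h1).
lra.
Unshelve. all: by end_near. Qed.

Lemma er_axis0 (R : realType) (F : R * R -> R) : even_ridge F -> F (0, 0) = 0.
Proof.
move=> H; have [d d0 /(_ 0)] := er_taylor H ltr01.
by rewrite normr0 expr0n /= !mulr0 subr0 normr_le0 => /(_ d0)/eqP.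
Qed.

Lemma er_axis_ge0 (R : realType) (F : R * R -> R) (y : R) :
  even_ridge F -> 0 <= F (0, y).
Proof.
move=> H; have [d d0 Hd] := er_taylor H ltr01.
have K (s : R) : `|s| < d -> - (1 * s ^+ 2) <= F (0, s).
  move=> /Hd; have := sqr_ge0 s; rewrite ler_norml => ? /andP[? _]; lra.
have cg := er_cont_axis H.
have [y0|y0|<-] := ltgtP 0 y; last by rewrite er_axis0.
  apply: (subsdiff_ge0 (K := 1) (g := fun t => F (0, t)) y0).
  - exact: continuous_subspaceT.
  - by move=> t _; exact: er_subsdiff.
  - exact: er_axis0.
  - apply: filterS (filterI (nbhs_right_gt (0 : R)) (nbhs_right_lt d0)) => s [s0 sd].
    by apply: K; rewrite gtr0_norm.
have ny0 : 0 < - y by rewrite oppr_gt0.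
rewrite -[y]opprK.
apply: (subsdiff_ge0 (K := 1) (g := fun t => F (0, - t)) ny0).
- apply: continuous_subspaceT => t.
  by apply: (@continuous_comp _ _ _ -%R (fun t => F (0, t))); [exact: opp_continuous|exact: cg].
- move=> t _ e e0; move: (er_subsdiff (- t) H e0); apply: filterS => h.
  by rewrite /sdiff opprD opprB [h - t]addrC; lra.
- by rewrite oppr0 er_axis0.
- apply: filterS (filterI (nbhs_right_gt (0 : R)) (nbhs_right_lt d0)) => s [s0 sd].
  by rewrite -(sqrrN s); apply: K; rewrite normrN gtr0_norm.
Qed.

Lemma er_axis_le (R : realType) (F : R * R -> R) (r M y : R) : even_ridge F ->
  0 < r -> F (0, r) <= M -> F (0, - r) <= M -> `|y| <= r -> F (0, y) <= M.
Proof.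
move=> H r0 H1 H2; rewrite ler_norml => yr.
rewrite -subr_le0; apply: (subsdiff_max (g := fun t => F (0, t) - M) (a := - r) (b := r)) => //.
- lra.
- apply: continuous_subspaceT => t; apply: cvgB; last exact: cvg_cst.
  exact: er_cont_axis.
- move=> t _ e e0; move: (er_subsdiff t H e0); apply: filterS => h.
  by rewrite /sdiff; lra.
- by rewrite subr_le0.
- by rewrite subr_le0.
Qed.

Lemma continuous_affine (R : realType) (f : R * R -> R) (c a b : R) (p : R * R) :
  {for (c * p.1 + a, c * p.2 + b), continuous f} ->
  {for p, continuous (fun q => f (c * q.1 + a, c * q.2 + b))}.
Proof.
move=> cf.
have H : (fun q : R * R => (c * q.1 + a, c * q.2 + b)) @ p --> (c * p.1 + a, c * p.2 + b).
  apply: (@cvg_pair _ _ _ (nbhs p) (nbhs (c * p.1 + a)) (nbhs (c * p.2 + b))).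
    by apply: cvgD; [apply: cvgMl_tmp; exact: cvg_fst|exact: cvg_cst].
  by apply: cvgD; [apply: cvgMl_tmp; exact: cvg_snd|exact: cvg_cst].
exact: (cvg_comp _ _ H cf).
Qed.

Lemma harm_on_affine (R : realType) (A B : set (R * R)) (f : R * R -> R) (c a b : R) :
  0 < c -> (forall p, A p -> B (c * p.1 + a, c * p.2 + b)) -> harm_on B f ->
  harm_on A (fun q => f (c * q.1 + a, c * q.2 + b)).
Proof.
move=> c0 AB hf p /AB /hf [c1 c2]; split; first exact: continuous_affine.
exact: harm_affine.
Qed.

Lemma harm_on_mirror (R : realType) (A B : set (R * R)) (f : R * R -> R) :
  (forall p, A p -> B (mirror p)) -> harm_on B f ->
  harm_on A (fun q => f (mirror q)).
Proof.
move=> AB hf p /AB /hf [c1 c2]; split; last exact: harm_reflect.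
exact: (cvg_comp _ _ (@continuous_mirror R p) c1).
Qed.

Lemma harm_onB (R : realType) (A : set (R * R)) (f g : R * R -> R) :
  harm_on A f -> harm_on A g -> harm_on A (fun q => f q - g q).
Proof.
move=> hf hg p Ap; have [f1 f2] := hf p Ap; have [g1 g2] := hg p Ap.
by split; [exact: cvgB|exact: harmB].
Qed.

Lemma disc_coord (R : realType) (r : R) (p : R * R) : 0 <= r -> disc r p ->
  `|p.1| <= r /\ `|p.2| <= r.
Proof.
rewrite /disc /sqnorm /= => r0 H; have := sqr_ge0 p.1; have := sqr_ge0 p.2 => y2 x2.
by split; rewrite -(@ler_pXn2r _ 2)// ?nnegrE// real_normK ?num_real//; lra.
Qed.

(** Harnack's inequality for M - F turns the upper bound of F on the axis into
    a lower bound in the strip. *)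
Lemma er_lower (R : realType) (F : R * R -> R) (c : R) : even_ridge F ->
  0 < c -> c < 1 -> exists2 K, 0 <= K & forall r M p, 0 < r ->
    F (0, r) <= M -> F (0, - r) <= M -> `|p.1| <= c -> `|p.2| <= r - 1 ->
    - (K * M) <= F p.
Proof.
move=> H c0 c1; pose d := (1 + c) / 2.
have d0 : 0 < d by rewrite /d; lra.
have d1 : d < 1 by rewrite /d; lra.
have cd : c < d by rewrite /d; lra.
have dn0 : d != 0 by rewrite gt_eqF.
have rho0 : 0 < c / d by rewrite divr_gt0.
have rho1 : c / d < 1 by rewrite ltr_pdivrMr// mul1r.
pose k := (1 - c / d) ^+ 2.
have k0 : 0 < k by rewrite exprn_gt0// subr_gt0.
exists k^-1; first by rewrite invr_ge0 ltW.
move=> r M p r0 H1 H2 p1 p2.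
have M0 : 0 <= M by apply: le_trans H1; exact: er_axis_ge0.
have dom q : disc 1 q -> `|d * q.1 + 0| < 1 /\ `|d * q.2 + p.2| <= r.
  move=> /(disc_coord ler01)[q1 q2]; split.
    rewrite addr0 normrM gtr0_norm//; apply: le_lt_trans d1.
    by rewrite ler_piMr// ltW.
  apply: le_trans (ler_normD _ _) _; rewrite normrM gtr0_norm//.
  have : d * `|q.2| <= 1 by rewrite mulr_ile1// ltW.
  lra.
have hf : harm_on (disc 1) (fun q => M - F (d * q.1 + 0, d * q.2 + p.2)).
  apply: harm_onB; first by move=> q _; split; [exact: cvg_cst|exact: harm_cst].
  by apply: (harm_on_affine d0 _ (er_harm H)) => q /dom[].
have pos q : disc 1 q -> 0 <= M - F (d * q.1 + 0, d * q.2 + p.2).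
  move=> /dom[q1 q2]; rewrite subr_ge0; apply: le_trans (er_ridge H _) _ => //=.
  exact: (er_axis_le H r0).
have Dq : disc (c / d) (p.1 / d, 0).
  rewrite /disc /sqnorm /= expr0n /= addr0 -real_normK ?num_real//.
  rewrite lerXn2r ?nnegrE ?(ltW rho0)// normrM normfV (gtr0_norm d0).
  by rewrite ler_pM2r ?invr_gt0.
have := harnack hf pos rho0 rho1 Dq; rewrite -/k /= !mulr0 !add0r !addr0.
have -> : d * (p.1 / d) = p.1 by rewrite mulrC divfK.
rewrite -surjective_pairing => Hk.
have {}Hk : k * (M - F p) <= M.
  by apply: le_trans Hk _; rewrite gerBl er_axis_ge0.
have : M - F p <= k^-1 * M by rewrite mulrC ler_pdivlMr// mulrC.
lra.
Qed.

(** A positive superharmonic function in the strip, of exponential growth. *)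
Definition barrier (R : realType) (p : R * R) : R :=
  (1 - p.1 ^+ 2) * (expR p.2 + expR (- p.2)).

Lemma continuous_barrier (R : realType) : continuous (@barrier R).
Proof.
move=> p; rewrite /barrier; apply: cvgM.
  by apply: cvgB; [exact: cvg_cst|apply: cvgM; exact: cvg_fst].
have ce (f : R * R -> R) : {for p, continuous f} ->
    {for p, continuous (fun q => expR (f q))}.
  by move=> cf; apply: (@continuous_comp _ _ _ f expR) => //; exact: continuous_expR.
apply: cvgD; apply: ce; first exact: cvg_snd.
by apply: cvgN; exact: cvg_snd.
Qed.

(** The second difference of the exponential factor is at most
    2 h^2 / (1 - h^2) times that factor, by exp h <= 1 / (1 - h); it is
    outweighed by the - 2 h^2 of the quadratic factor as soon as h < x. *)
Lemma subh_barrier (R : realType) (p : R * R) : 0 < p.1 -> p.1 < 1 ->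
  subh (fun q => - barrier q) p.
Proof.
move=> x0 x1 e e0; near=> h.
have h0 : 0 < h by [].
have hx : h < p.1 by near: h; exact: nbhs_right_lt.
apply: (@le_trans _ _ 0); first by rewrite oppr_le0 mulr_ge0 ?sqr_ge0// ltW.
rewrite /cross_sum /barrier /=.
rewrite opprD opprB (expRD p.2 h) (expRD p.2 (- h)) (expRD (- p.2) (- h)) (expRD h (- p.2)).
set A := expR p.2; set A' := expR (- p.2); set B := expR h; set B' := expR (- h).
have A0 : 0 < A by exact: expR_gt0.
have A'0 : 0 < A' by exact: expR_gt0.
have hh : h ^+ 2 < p.1 ^+ 2 by rewrite ltr_pXn2r// ?nnegrE ltW//; exact: lt_trans hx.
have x2 : p.1 ^+ 2 < 1 by rewrite expr_lt1// ltW.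
have BB : (1 - h ^+ 2) * (B + B' - 2) <= 2 * h ^+ 2.
  have BB' : B * B' = 1 by rewrite /B /B' expRN divff// gt_eqF// expR_gt0.
  have h1 : 1 + h <= B by exact: expR_ge1Dx.
  have h2 : 1 - h <= B' by exact: expR_ge1Dx.
  have B0 : 0 <= B := expR_ge0 h.
  have B'0 : 0 <= B' := expR_ge0 (- h).
  have b1 : (1 - h) * B <= 1 by have := ler_wpM2l B0 h2; rewrite BB' mulrC.
  have b2 : (1 + h) * B' <= 1 by have := ler_wpM2r B'0 h1; rewrite BB'.
  have hl : 0 <= 1 - h by lra.
  have hp : 0 <= 1 + h by lra.
  have := ler_wpM2l hp b1; have := ler_wpM2l hl b2; lra.
have q : (1 - p.1 ^+ 2) * (B + B' - 2) <= 2 * h ^+ 2.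
  have [bp|bn] := leP 0 (B + B' - 2).
    apply: le_trans BB; apply: ler_wpM2r => //; lra.
  apply: (@le_trans _ _ 0); last by rewrite mulr_ge0 ?sqr_ge0.
  by rewrite mulr_ge0_le0// ?ltW//; lra.
have AA : 0 <= A + A' by lra.
have := ler_wpM2l AA q.
have := sqr_ge0 h; lra.
Unshelve. all: by end_near. Qed.

Lemma compact_box (R : realType) (a b c d : R) :
  compact [set p : R * R | a <= p.1 <= b /\ c <= p.2 <= d].
Proof.
have -> : [set p : R * R | a <= p.1 <= b /\ c <= p.2 <= d] = `[a, b] `*` `[c, d].
  by apply/seteqP; split => -[x y] /=; rewrite !in_itv.
by apply: compact_setX; exact: segment_compact.
Qed.

Lemma nbhs_box (R : realType) (a b c d : R) (p : R * R) :
  a < p.1 < b -> c < p.2 < d ->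
  nbhs p [set p : R * R | a <= p.1 <= b /\ c <= p.2 <= d].
Proof.
move=> /andP[ap pb] /andP[cp pd].
have N1 (f : R * R -> R) (e : R) : {for p, continuous f} -> e < f p ->
    nbhs p [set q | e < f q].
  by move=> cf ef; exact: (cf _ (lt_nbhsr ef)).
have N2 (f : R * R -> R) (e : R) : {for p, continuous f} -> f p < e ->
    nbhs p [set q | f q < e].
  by move=> cf ef; exact: (cf _ (lt_nbhsl ef)).
have c1 : {for p, continuous (fst : R * R -> R)} by exact: cvg_fst.
have c2 : {for p, continuous (snd : R * R -> R)} by exact: cvg_snd.
near=> q.
have q1 : a < q.1 by near: q; exact: N1.
have q2 : q.1 < b by near: q; exact: N2.
have q3 : c < q.2 by near: q; exact: N1.
have q4 : q.2 < d by near: q; exact: N2.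
by rewrite /= !ltW.
Unshelve. all: by end_near. Qed.

(** Moving planes: reflecting F in the line of abscissa a gives a difference
    that is harmonic in the strip between 0 and a, vanishes on the line and is
    nonpositive on the axis by the ridge property; it grows more slowly than
    the barrier, as in the Phragmen-Lindelof principle. *)
Lemma er_reflect_le (R : realType) (F : R * R -> R) (a x y : R) : even_ridge F ->
  0 < a -> a < 1 / 2 -> 0 <= x <= a -> F (a + x, y) <= F (a - x, y).
Proof.
move=> H a0 a1 /andP[x0 xa].
have a2 : 0 < 2 * a by lra.
have a21 : 2 * a < 1 by lra.
have [K K0 HK] := er_lower H a2 a21.
pose E (q : R * R) := F (1 * q.1 + a, 1 * q.2 + 0) - F (1 * (mirror q).1 + a, 1 * (mirror q).2 + 0).
have EE q : E q = F (a + q.1, q.2) - F (a - q.1, q.2).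
  by rewrite /E /= !mul1r !addr0 [q.1 + a]addrC [- q.1 + a]addrC.
have hE : harm_on [set q | 0 <= q.1 <= a] E.
  apply: harm_onB.
    apply: (harm_on_affine _ _ (er_harm H)) => // q /= /andP[q0 qa].
    by rewrite mul1r ger0_norm; lra.
  pose B := [set q : R * R | - a <= q.1 <= 0].
  apply: (@harm_on_mirror _ _ B (fun q => F (1 * q.1 + a, 1 * q.2 + 0))).
    by move=> q /= /andP[q0 qa]; rewrite /B /=; apply/andP; split; lra.
  apply: (harm_on_affine _ _ (er_harm H)) => // q /= /andP[q0 qa].
  by rewrite mul1r ger0_norm; lra.
have S0 : 0 < barrier (x, y).
  rewrite mulr_gt0//=; last by rewrite addr_gt0// expR_gt0.
  by rewrite subr_gt0 expr_lt1//; lra.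
rewrite -subr_le0 -[F _ - _]/(F (a + (x, y).1, (x, y).2) - F (a - (x, y).1, (x, y).2)) -EE.
apply: (le_of_eps S0) => e e0; rewrite add0r mulrC.
(* On the horizontal sides of a box of half-height r - 1 the barrier is at least
   (3 / 4) expR (r - 1), while the difference is at most (1 + K) expR (r / 2). *)
pose c := e * (3 / 4) * expR (- 1).
have c0 : 0 < c by rewrite !mulr_gt0// ?expR_gt0//; lra.
have [r rN [r1 r2]] := er_growth H (2 * ((1 + K) / c) + `|y| + 2).
have q0 : 0 <= (1 + K) / c by rewrite divr_ge0 ?ltW//; lra.
have y0 : 0 <= `|y| by [].
have r0 : 0 < r by lra.
have ry : `|y| <= r - 1 by lra.
set M := expR (r / 2) in r1 r2.
have Mc : (1 + K) * M <= e * ((3 / 4) * expR (r - 1)).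
  have -> : expR (r - 1) = M * M * expR (- 1).
    by rewrite /M -!expRD; congr expR; field.
  have : 1 + K <= c * M.
    rewrite mulrC -ler_pdivrMr//; have := expR_ge1Dx (r / 2); rewrite -/M; lra.
  have M0 : 0 <= M by rewrite ltW// expR_gt0.
  by move/(ler_wpM2r M0); rewrite /c; lra.
pose Q := [set p : R * R | 0 <= p.1 <= a /\ - (r - 1) <= p.2 <= r - 1].
have Qxy : Q (x, y) by split=> /=; [rewrite x0|rewrite -ler_norml].
rewrite -subr_le0.
apply: (max_principle (K := Q) (f := fun q => E q - e * barrier q)) => //.
- exact: compact_box.
- move=> q [q1 q2]; apply: cvgB; first by have [] := hE q q1.
  by apply: cvgMl_tmp; exact: continuous_barrier.
move=> q [q1 q2]; have /andP[q10 q1a] := q1.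
have bq : 0 <= barrier q.
  apply: mulr_ge0; last by rewrite addr_ge0 ?expR_ge0.
  by rewrite subr_ge0 expr_le1//; lra.
have [z|z] := eqVneq q.1 0.
  left; rewrite EE z addr0 subr0 subrr sub0r oppr_le0 mulr_ge0//; exact: ltW.
have [z'|z'] := eqVneq q.1 a.
  left; rewrite EE z' subrr.
  have := er_ridge H (p := (a + a, q.2)); rewrite /= ger0_norm; last by lra.
  have eb : 0 <= e * barrier q by rewrite mulr_ge0// ltW.
  have aa : a + a < 1 by lra.
  by move=> /(_ aa); lra.
have [z''|z''] := eqVneq `|q.2| (r - 1).
  left; rewrite EE.
  have u1 : F (a + q.1, q.2) <= M.
    apply: le_trans (er_ridge H _) _ => /=; first by rewrite ger0_norm; lra.
    by apply: (er_axis_le H r0) => //; rewrite z''; lra.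
  have u2 : - (K * M) <= F (a - q.1, q.2).
    apply: (HK r) => //=; first by rewrite ger0_norm; lra.
    by rewrite z''.
  have u3 : e * ((3 / 4) * expR (r - 1)) <= e * barrier q.
    apply: ler_wpM2l; first exact: ltW.
    have u4 : 3 / 4 <= 1 - q.1 ^+ 2.
      have : q.1 ^+ 2 <= (1 / 2) ^+ 2 by rewrite lerXn2r// ?nnegrE; lra.
      have -> : (1 / 2) ^+ 2 = 1 / 4 :> R by field.
      lra.
    apply: ler_pM; [lra|exact: expR_ge0|exact: u4|].
    rewrite -z''; have [qp|qn] := leP 0 q.2.
      by rewrite ger0_norm// lerDl expR_ge0.
    by rewrite ltr0_norm// lerDr expR_ge0.
  lra.
right; split.
  apply: nbhs_box; first by rewrite !lt_neqAle z' eq_sym z q1.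
  rewrite -ltr_norml lt_neqAle z'' /=.
  by rewrite ler_norml.
have [_ [sE _]] := hE q q1.
apply: subhD => //.
have -> : (fun q => - (e * barrier q)) = (fun q => e * - barrier q).
  by apply/funext => p; rewrite mulrN.
apply: subhZ; first exact: ltW.
by apply: subh_barrier; [rewrite lt_neqAle eq_sym z; case/andP: q1|lra].
Qed.

(** The points s and t are mirror images in the line of abscissa (s + t) / 2. *)
Lemma er_decreasing (R : realType) (F : R * R -> R) (s t y : R) : even_ridge F ->
  0 <= s -> s <= t -> s + t < 1 -> F (t, y) <= F (s, y).
Proof.
move=> H s0 st st1; have [t0|t0] := eqVneq t 0.
  by have -> : s = t by lra.
have tp : 0 < t by rewrite lt_neqAle eq_sym t0 (le_trans s0).
have := er_reflect_le (a := (s + t) / 2) (x := (t - s) / 2) y H.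
have -> : (s + t) / 2 + (t - s) / 2 = t by field.
have -> : (s + t) / 2 - (t - s) / 2 = s by field.
by apply; lra.
Qed.

(** * Even ridge functions: quadratic bound and cubic remainder *)

(** Harmonicity at the origin turns the expansion y^2 / 2 on the axis into
    - x^2 / 2 in the horizontal direction. *)
Lemma er_origin (R : realType) (F : R * R -> R) : even_ridge F ->
  exists2 d, 0 < d & forall h, 0 < h < d -> - F (h, 0) <= h ^+ 2.
Proof.
move=> H; have q0 : 0 < 1 / 4 :> R by lra.
have h0 : 0 < 1 / 2 :> R by lra.
have D : `|((0 : R), (0 : R)).1| < 1 by rewrite normr0.
have [_ [sF _]] := er_harm H D.
have [d1 d10 T] := er_taylor H q0.
have [d2 /= d20 S] := sF _ h0.
exists (Num.min d1 d2) => [|h /andP[hp hd]]; first by rewrite lt_min d10.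
have hd1 : h < d1 by apply: lt_le_trans hd _; rewrite ge_min lexx.
have hd2 : h < d2 by apply: lt_le_trans hd _; rewrite ge_min lexx orbT.
have := S h; rewrite /ball_ /= sub0r normrN gtr0_norm// => /(_ hd2 hp).
rewrite (cross_sum_axis _ _ (er_even H)) /sdiff (er_axis0 H) add0r sub0r.
have := T h; rewrite gtr0_norm// => /(_ hd1).
have := T (- h); rewrite normrN gtr0_norm// => /(_ hd1).
by rewrite sqrrN !ler_norml => /andP[_ t1] /andP[_ t2]; lra.
Qed.

(** The odd function F (x - s, y) - F (x + s, y) is nonnegative to the right of
    the axis, so the boundary Harnack inequality compares it with its value at
    a point near the origin, where the normalization of F controls it. *)
Lemma er_shift (R : realType) (F : R * R -> R) : even_ridge F ->
  exists2 d, 0 < d & forall s p, 0 < s < d -> disc (81 / 200) p -> 0 <= p.1 ->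
    F (p.1 - s, p.2) - F (p.1 + s, p.2) <= 4 * 10 ^+ 5 * p.1 * s.
Proof.
move=> H; have [d d0 Hd] := er_origin H.
exists (Num.min (1 / 20) (d / 2)); first by rewrite lt_min; apply/andP; split; lra.
move=> s p /andP[s0 sd] Dp p0.
have s1 : s < 1 / 20 by apply: lt_le_trans sd _; rewrite ge_min lexx.
have s2 : s < d / 2 by apply: lt_le_trans sd _; rewrite ge_min lexx orbT.
(* The disc of radius 9 / 20 and shifts s < 1 / 20 stay in the region where
   er_decreasing applies; 81 / 200 is 9 / 10 of that radius. *)
pose c := 9 / 20 : R.
have c0 : 0 < c by rewrite /c; lra.
have cn0 : c != 0 by rewrite gt_eqF.
pose V (q : R * R) := F (c * q.1 + - s, c * q.2 + 0) - F (c * q.1 + s, c * q.2 + 0).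
have cq (q : R * R) : disc 1 q -> `|c * q.1| <= 9 / 20.
  move=> /(disc_coord ler01)[q1 _]; rewrite normrM gtr0_norm//.
  by rewrite /c; lra.
have hV : harm_on (disc 1) V.
  apply: harm_onB; apply: (harm_on_affine _ _ (er_harm H)) => // q /cq /=.
    by rewrite ler_norml ltr_norml => /andP[? ?]; apply/andP; split; lra.
  by rewrite ler_norml ltr_norml => /andP[? ?]; apply/andP; split; lra.
have oddV q : V (mirror q) = - V q.
  rewrite /V /= mulrN -(er_even H (- _ + - s, _)) -(er_even H (- _ + s, _)).
  by rewrite /mirror /= !opprD !opprK; ring.
have posV q : disc 1 q -> 0 <= q.1 -> 0 <= V q.
  move=> Dq q0; have := cq q Dq; rewrite /V; set X := c * q.1.
  have X0 : 0 <= X by rewrite mulr_ge0// ltW.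
  rewrite ger0_norm// subr_ge0 => X1.
  have [Xs|Xs] := leP s X; first by apply: (er_decreasing _ H); lra.
  rewrite -(er_even H (X + - s, _)) /mirror /= opprD opprK.
  by apply: (er_decreasing _ H); lra.
have Dp' : disc (9 / 10) (p.1 / c, p.2 / c).
  move: Dp; rewrite /disc /sqnorm /= (expr_div_n p.1) (expr_div_n p.2) -mulrDl.
  rewrite ler_pdivrMr ?exprn_gt0//.
  have c9 : 9 / 10 * c = 81 / 200 by rewrite /c; field.
  by rewrite -exprMn c9.
have x00 : 0 < s / c by rewrite divr_gt0.
have x01 : s / c <= 1 / 2 by rewrite ler_pdivrMr// /c; lra.
have p0' : 0 <= (p.1 / c, p.2 / c).1 by rewrite divr_ge0// ltW.
have := boundary_harnack hV oddV posV Dp' p0' x00 x01.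
rewrite /V /=.
have cK x : c * (x / c) = x by rewrite mulrC divfK.
rewrite !cK mulr0 !addr0 subrr (er_axis0 H) sub0r.
have V0 : - F (s + s, 0) <= (s + s) ^+ 2 by apply: Hd; apply/andP; split; lra.
set W := F _ - F _; set K := 10 ^+ 5 => B.
have K0 : 0 <= K by rewrite exprn_ge0.
have B2 : s / c * W <= K * (p.1 / c) * (s + s) ^+ 2.
  by apply: le_trans B _; apply: ler_wpM2l => //; rewrite mulr_ge0.
rewrite -(ler_pM2l x00); apply: le_trans B2 _.
by rewrite le_eqVlt; apply/orP; left; apply/eqP; field.
Qed.

(** Telescoping er_shift over the points s, 3 s, 5 s, and so on up to x - s,
    with x = 2 n s and n large. *)
Lemma er_quadratic (R : realType) (F : R * R -> R) (p : R * R) : even_ridge F ->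
  disc (81 / 200) p -> F (0, p.2) - F p <= 4 * 10 ^+ 5 * p.1 ^+ 2.
Proof.
move=> H.
wlog p0 : p / 0 <= p.1 => [W|] Dp.
  have [/W|/ltW pn] := leP 0 p.1; first exact.
  have := W (mirror p); rewrite (er_even H) /= sqrrN; apply.
    by rewrite oppr_ge0.
  by rewrite /disc /= sqnorm_mirror.
set L := 4 * 10 ^+ 5 : R.
have L0 : 0 <= L by rewrite mulr_ge0// exprn_ge0.
have [p10|pn0] := eqVneq p.1 0.
  have -> : p = (0, p.2) by rewrite -p10 -surjective_pairing.
  by rewrite subrr mulr_ge0// sqr_ge0.
have x0 : 0 < p.1 by rewrite lt_neqAle eq_sym pn0.
have [d d0 Hd] := er_shift H.
set n := Num.bound (p.1 / d).
have nb : p.1 / d < n%:R.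
  by apply: archi_boundP; rewrite divr_ge0// ltW.
have n0 : 0 < n%:R :> R by apply: le_lt_trans nb; rewrite divr_ge0// ltW.
pose s := p.1 / (2 * n%:R).
have n20 : 0 < 2 * n%:R :> R by rewrite mulr_gt0.
have s0 : 0 < s by rewrite divr_gt0.
have nx : p.1 = 2 * n%:R * s by rewrite /s mulrC divfK ?gt_eqF.
have sd : s < d.
  rewrite /s ltr_pdivrMr//; move: nb; rewrite ltr_pdivrMr// => nb.
  have : 0 < n%:R * d by rewrite mulr_gt0.
  lra.
have step k : (k <= n)%N -> F (0, p.2) - F (2 * k%:R * s, p.2) <= k%:R * (L * p.1 * s).
  elim: k => [_|k IH kn]; first by rewrite mulr0 !mul0r subrr.
  have kn' : k%:R + 1 <= n%:R :> R by rewrite natr1 ler_nat.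
  have k0 : 0 <= k%:R :> R by [].
  have := IH (ltnW kn).
  have le1 : (2 * k%:R + 1) * s <= p.1.
    by rewrite nx ler_pM2r//; lra.
  have ge1 : 0 <= (2 * k%:R + 1) * s by rewrite mulr_ge0 ?ltW//; lra.
  have Dk : disc (81 / 200) ((2 * k%:R + 1) * s, p.2).
    apply: le_trans Dp; rewrite /sqnorm /= lerD2r lerXn2r// ?nnegrE//.
  have := Hd s _ _ Dk; rewrite s0 sd /= => /(_ isT ge1).
  have -> : (2 * k%:R + 1) * s - s = 2 * k%:R * s by ring.
  have -> : (2 * k%:R + 1) * s + s = 2 * k.+1%:R * s by rewrite -natr1; ring.
  rewrite -/L; have Ls : 0 <= L * s by rewrite mulr_ge0// ltW.
  have := ler_wpM2l Ls le1.
  have -> : k.+1%:R * (L * p.1 * s) = k%:R * (L * p.1 * s) + L * p.1 * s.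
    by rewrite -natr1; ring.
  have -> : L * s * ((2 * k%:R + 1) * s) = L * ((2 * k%:R + 1) * s) * s by ring.
  have -> : L * s * p.1 = L * p.1 * s by ring.
  lra.
have := step n (leqnn n); rewrite -nx -surjective_pairing.
have -> : n%:R * (L * p.1 * s) = L * p.1 ^+ 2 / 2.
  have ns : n%:R * s = p.1 / 2 by move: nx; set a := n%:R * s; rewrite -mulrA -/a; lra.
  have -> : n%:R * (L * p.1 * s) = L * p.1 * (n%:R * s) by ring.
  by rewrite ns; ring.
have : 0 <= L * p.1 ^+ 2 by rewrite mulr_ge0// sqr_ge0.
lra.
Qed.

(** By er_quadratic and cross_sum_axis the second difference of F on the axis is
    at most that of L y^2 up to o (h^2), so L y^2 - F (0, y) is convex and
    subsdiff_ge0 applies to it. *)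
Lemma er_axis_upper (R : realType) (F : R * R -> R) (y : R) : even_ridge F ->
  `|y| <= 2 / 5 -> F (0, y) <= 4 * 10 ^+ 5 * y ^+ 2.
Proof.
move=> H; set L := 4 * 10 ^+ 5 : R.
have L0 : 0 <= L by rewrite mulr_ge0// exprn_ge0.
have [d d0 Hd] := er_taylor H ltr01.
have K (s : R) : `|s| < d -> - (2 * s ^+ 2) <= L * s ^+ 2 - F (0, s).
  move=> /Hd; have s2 := sqr_ge0 s; have := mulr_ge0 L0 s2.
  by rewrite ler_norml => ? /andP[_ ?]; lra.
have cg := er_cont_axis H.
have sub t : `|t| < 2 / 5 -> subsdiff (fun y => L * y ^+ 2 - F (0, y)) t.
  move=> tb e e0.
  have D : `|((0 : R), t).1| < 1 by rewrite normr0.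
  have [_ [_ sF]] := er_harm H D.
  near=> h.
  have h0 : 0 < h by [].
  have h1 : h < 1 / 20 by near: h; apply: nbhs_right_lt; lra.
  have : - (e * h ^+ 2) <= cross_sum (fun q => - F q) (0, t) h by near: h; exact: sF.
  have -> : cross_sum (fun q => - F q) (0, t) h = - cross_sum F (0, t) h.
    by rewrite /cross_sum; ring.
  rewrite (cross_sum_axis _ _ (er_even H)).
  have Dh : disc (81 / 200) (h, t).
    rewrite /disc /sqnorm /=.
    have : t ^+ 2 <= (2 / 5) ^+ 2.
      by rewrite -real_normK ?num_real// lerXn2r// ?nnegrE; lra.
    have : h ^+ 2 <= (1 / 20) ^+ 2 by rewrite lerXn2r// ?nnegrE; lra.
    have -> : (1 / 20) ^+ 2 = 1 / 400 :> R by field.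
    have -> : (2 / 5) ^+ 2 = 4 / 25 :> R by field.
    have -> : 81 / 200 = 2 / 5 + 1 / 200 :> R by field.
    have -> : (2 / 5 + 1 / 200) ^+ 2 = 4 / 25 + 1 / 250 + (1 / 200) ^+ 2 :> R by field.
    by have := sqr_ge0 (1 / 200 : R); lra.
  have /= := er_quadratic H Dh; rewrite -/L.
  have -> : sdiff (fun y => L * y ^+ 2 - F (0, y)) t h =
     2 * (L * h ^+ 2) - sdiff (fun y => F (0, y)) t h by rewrite /sdiff; ring.
  lra.
have cL (f : R -> R) : continuous f -> continuous (fun t => L * f t ^+ 2 - F (0, f t)).
  move=> cf t; apply: cvgB; first by apply: cvgMl_tmp; apply: cvgM; exact: cf.
  by apply: (@continuous_comp _ _ _ f (fun t => F (0, t))); [exact: cf|exact: cg].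
have nr : \forall s \near (0 : R)^'+, 0 < s /\ s < d.
  exact: filterI (nbhs_right_gt (0 : R)) (nbhs_right_lt d0).
rewrite ler_norml => /andP[y1 y2]; rewrite -subr_ge0.
have [y0|y0|<-] := ltgtP 0 y; last by rewrite er_axis0// expr0n /= mulr0 subrr.
  apply: (subsdiff_ge0 (K := 2) (g := fun t => L * t ^+ 2 - F (0, t)) y0).
  - by apply: continuous_subspaceT; apply: (cL id) => t; exact: cvg_id.
  - by move=> t /andP[t0 ty]; apply: sub; rewrite gtr0_norm//; lra.
  - by rewrite er_axis0// expr0n /= mulr0 subrr.
  - by apply: filterS nr => s [s0 sd]; apply: K; rewrite gtr0_norm.
have ny0 : 0 < - y by rewrite oppr_gt0.
rewrite -[y]opprK.
apply: (subsdiff_ge0 (K := 2) (g := fun t => L * (- t) ^+ 2 - F (0, - t)) ny0).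
- by apply: continuous_subspaceT; apply: (cL -%R); exact: opp_continuous.
- move=> t /andP[t0 ty] e e0.
  have ts : `|- t| < 2 / 5 by rewrite normrN gtr0_norm//; lra.
  move: (sub _ ts e e0); apply: filterS => h.
  by rewrite /sdiff opprD opprB [h - t]addrC; lra.
- by rewrite oppr0 er_axis0// expr0n /= mulr0 subrr.
- by apply: filterS nr => s [s0 sd]; rewrite -(sqrrN s); apply: K; rewrite normrN gtr0_norm.
Unshelve. all: by end_near. Qed.

(** The previous bounds hold on the disc of radius 2 / 5, and rescaling it to the
    unit disc turns the radius 5 / 6 of even_cubic_remainder into 1 / 3. *)
Lemma er_cubic (R : realType) : exists2 c0 : R, 0 < c0 &
  forall F (p : R * R), even_ridge F -> disc (1 / 3) p ->
    `|F p + 2^-1 * (p.1 ^+ 2 - p.2 ^+ 2)| <= c0 * modulus (toC p) ^+ 3.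
Proof.
set L := 4 * 10 ^+ 5 : R.
have L0 : 0 < L by rewrite mulr_gt0// exprn_gt0.
exists (12 * L * (5 / 2) ^+ 3) => [|F p H Dp].
  by rewrite !mulr_gt0// ?exprn_gt0//; lra.
have h25 : 0 < 2 / 5 :> R by lra.
have FL q : disc (2 / 5) q -> `|F q| <= L.
  move=> Dq; have [q1 q2] := disc_coord (ltW h25) Dq.
  have e1 : (2 / 5) ^+ 2 = 4 / 25 :> R by field.
  have q12 : q.1 ^+ 2 <= 4 / 25.
    by rewrite -e1 -real_normK ?num_real// lerXn2r// ?nnegrE; lra.
  have q22 : q.2 ^+ 2 <= 4 / 25.
    by rewrite -e1 -real_normK ?num_real// lerXn2r// ?nnegrE; lra.
  have q1' : `|q.1| < 1 by lra.
  have h1 := er_ridge H q1'.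
  have h2 := er_axis_upper H q2.
  have Dq' : disc (81 / 200) q by apply: disc_sub Dq; lra.
  have h3 := er_quadratic H Dq'.
  have h4 := er_axis_ge0 q.2 H.
  have h5 : L * q.1 ^+ 2 <= L * (4 / 25) by rewrite ler_pM2l.
  have h6 : L * q.2 ^+ 2 <= L * (4 / 25) by rewrite ler_pM2l.
  rewrite ler_norml; apply/andP; split.
    by move: h3; rewrite -/L; lra.
  by move: h2; rewrite -/L; lra.
pose G (q : R * R) := F (2 / 5 * q.1 + 0, 2 / 5 * q.2 + 0).
have hG : harm_on (disc 1) G.
  apply: (harm_on_affine h25 _ (er_harm H)) => q /(disc_coord ler01)[q1 _] /=.
  by rewrite addr0 normrM gtr0_norm//; lra.
have eG q : G (mirror q) = G q.
  by rewrite /G /= !addr0 mulrN -[LHS](er_even H) /mirror /= opprK.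
have GL q : disc 1 q -> `|G q| <= L.
  move=> Dq; apply: FL; move: Dq; rewrite /disc /sqnorm /= !addr0.
  rewrite [(_ * q.1) ^+ 2]exprMn [(_ * q.2) ^+ 2]exprMn -mulrDr.
  by rewrite expr1n => Dq; rewrite ler_piMr// sqr_ge0.
have tG t : 0 < t -> exists2 d, 0 < d & forall y, `|y| < d ->
     `|G (0, y) - 2 / 25 * y ^+ 2| <= t * y ^+ 2.
  move=> t0; have [d d0 T] := er_taylor H t0; exists d => // y yd.
  rewrite /G /= mulr0 !addr0.
  have yd' : `|2 / 5 * y| < d.
    by rewrite normrM gtr0_norm//; have := normr_ge0 y; lra.
  have := T _ yd'.
  have -> : 2^-1 * (2 / 5 * y) ^+ 2 = 2 / 25 * y ^+ 2 by field.
  move=> /le_trans; apply; rewrite ler_pM2l//.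
  have -> : (2 / 5 * y) ^+ 2 = 4 / 25 * y ^+ 2 by field.
  by have := sqr_ge0 y; lra.
pose q := (5 / 2 * p.1, 5 / 2 * p.2).
have Dq : disc (5 / 6) q.
  move: Dp; rewrite /disc /sqnorm /= [(_ * p.1) ^+ 2]exprMn [(_ * p.2) ^+ 2]exprMn -mulrDr.
  have -> : (5 / 6) ^+ 2 = (5 / 2) ^+ 2 * (1 / 3) ^+ 2 :> R by field.
  by rewrite ler_pM2l// exprn_gt0//; lra.
have := even_cubic_remainder hG eG GL tG Dq.
have -> : G q = F p.
  rewrite /G /q /= !addr0 [in RHS](surjective_pairing p).
  by congr (F (_, _)); field.
have -> : 2 / 25 * (q.1 ^+ 2 - q.2 ^+ 2) = 2^-1 * (p.1 ^+ 2 - p.2 ^+ 2).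
  by rewrite /q /=; field.
have -> : modulus (toC q) = 5 / 2 * modulus (toC p).
  rewrite -[X in X * _]gtr0_norm; last by lra.
  rewrite -modulusC -modulusM; congr modulus.
  by apply/eqP; rewrite eq_complex /=; apply/andP; split; apply/eqP; ring.
by rewrite exprMn mulrA.
Qed.

(** * Second-order expansions of C2 functions and even reflection *)

Lemma derive1_expansion (R : realType) (g : R -> R) (a e : R) :
  derivable g a 1 -> 0 < e -> exists2 d, 0 < d & forall h, `|h| < d ->
    `|g (a + h) - g a - derive1 g a * h| <= e * `|h|.
Proof.
move=> dg e0.
have H : (fun h : R => h^-1 *: ((g \o shift a) (h *: (1 : R)) - g a)) @ 0^' --> derive1 g a.
  by rewrite derive1E; exact: dg.
move/cvgrPdist_le/(_ e e0): H => -[d /= d0 Hd].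
exists d => // h hd; have [->|h0] := eqVneq h 0.
  by rewrite addr0 subrr mulr0 subr0 normr0 mulr0.
have := Hd h; rewrite /= sub0r normrN => /(_ hd h0).
rewrite /shift /= scaler1 [h + a]addrC.
have h0' : 0 < `|h| by rewrite normr_gt0.
move=> /(ler_wpM2r (ltW h0')); rewrite -normrM.
have -> // : g (a + h) - g a - derive1 g a * h =
  - ((derive1 g a - h^-1 *: (g (a + h) - g a)) * h).
  by rewrite /GRing.scale /=; field.
by rewrite normrN.
Qed.

Lemma MVT_sym (R : realType) (f df : R -> R) (a d t : R) :
  (forall x, `|x - a| < d -> is_derive x 1 f (df x)) -> `|t| < d ->
  exists2 c, `|c - a| <= `|t| & f (a + t) - f a = df c * t.
Proof.
move=> D td.
have cf (i : interval R) : (forall x, x \in i -> `|x - a| < d) -> {within [set` i], continuous f}.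
  move=> H; apply: derivable_within_continuous => x /H /D Dx.
  by have [] := Dx.
have [t0|t0] := leP 0 t.
  have at0 : a <= a + t by lra.
  have bnd x : x \in `[a, a + t] -> `|x - a| <= t.
    by rewrite in_itv /= ler_norml => /andP[? ?]; apply/andP; split; lra.
  rewrite ger0_norm// in td *.
  have Dx x : x \in `]a, a + t[ -> is_derive x 1 f (df x).
    by move=> /subset_itv_oo_cc xi; apply: D; apply: le_lt_trans td; exact: bnd.
  have Cx : {within `[a, a + t], continuous f}.
    by apply: cf => x xi; apply: le_lt_trans td; exact: bnd.
  have [c /bnd cat E] := MVT_segment at0 Dx Cx.
  by exists c => //; rewrite E; congr (_ * _); ring.
have at0 : a + t <= a by lra.
have bnd x : x \in `[a + t, a] -> `|x - a| <= - t.
  by rewrite in_itv /= ler_norml => /andP[? ?]; apply/andP; split; lra.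
rewrite ltr0_norm// in td *.
have Dx x : x \in `]a + t, a[ -> is_derive x 1 f (df x).
  by move=> /subset_itv_oo_cc xi; apply: D; apply: le_lt_trans td; exact: bnd.
have Cx : {within `[a + t, a], continuous f}.
  by apply: cf => x xi; apply: le_lt_trans td; exact: bnd.
have [c /bnd cat E] := MVT_segment at0 Dx Cx.
by exists c => //; rewrite -opprB E; ring.
Qed.

(** Peano's form of the remainder, from differentiability of g' at the single
    point a: the mean value theorem is applied to g minus its quadratic
    polynomial, whose derivative is o (t). *)
Lemma taylor2 (R : realType) (g : R -> R) (a r e : R) : 0 < r ->
  (forall x, `|x - a| < r -> derivable g x 1) -> derivable (derive1 g) a 1 ->
  0 < e -> exists2 d, 0 < d & forall t, `|t| < d ->
    `|g (a + t) - g a - derive1 g a * t - 2^-1 * derive1 (derive1 g) a * t ^+ 2|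
      <= e * t ^+ 2.
Proof.
move=> r0 dg dg' e0.
set g1 := derive1 g a; set g2 := derive1 (derive1 g) a.
have [d0 d00 Hd] := derive1_expansion dg' e0.
pose d := Num.min d0 r.
have d_0 : 0 < d by rewrite lt_min d00.
exists d => // t td.
pose f x := g x - (g1 * (x - a) + 2^-1 * g2 * (x - a) ^+ 2).
pose df x := derive1 g x - (g1 + g2 * (x - a)).
have Df x : `|x - a| < d -> is_derive x 1 f (df x).
  move=> xd; have xr : `|x - a| < r by apply: lt_le_trans xd _; rewrite ge_min lexx orbT.
  apply: is_deriveB.
    by apply: DeriveDef; [exact: dg|rewrite -derive1E].
  apply: is_derive_eq.
  by rewrite /GRing.scale /=; field.
have [c ca E] := MVT_sym Df td.
have -> : g (a + t) - g a - g1 * t - 2^-1 * g2 * t ^+ 2 = f (a + t) - f a.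
  by rewrite /f [a + t - a]addrC addKr subrr; ring.
have cd : `|c - a| < d0.
  by apply: le_lt_trans ca _; apply: lt_le_trans td _; rewrite ge_min lexx.
have := Hd _ cd; rewrite -/g1 -/g2 [a + _]addrC subrK => Hc.
rewrite E /df normrM opprD addrA.
have -> : e * t ^+ 2 = e * `|t| * `|t| by rewrite -mulrA -expr2 real_normK ?num_real.
apply: ler_wpM2r => //; apply: le_trans Hc _.
by rewrite ler_pM2l.
Qed.

(** Opposite second-order coefficients in the two directions express a
    vanishing Laplacian; a is the slope in the direction of x. *)
Definition harm_jet (R : realType) (f : R * R -> R) (p : R * R) (a : R) : Prop :=
  {for p, continuous f} /\
  exists b A, forall e : R, 0 < e -> exists2 d : R, 0 < d & forall t, `|t| < d ->
    `|f (p.1 + t, p.2) - f p - a * t - A * t ^+ 2| <= e * t ^+ 2 /\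
    `|f (p.1, p.2 + t) - f p - b * t + A * t ^+ 2| <= e * t ^+ 2.

Lemma harm_of_cross (R : realType) (f : R * R -> R) (p : R * R) :
  (forall e, 0 < e -> \forall h \near (0 : R)^'+, `|cross_sum f p h| <= e * h ^+ 2) ->
  harm f p.
Proof.
move=> H; split=> e e0; move: (H e e0); apply: filterS => h.
  by rewrite ler_norml => /andP[].
have -> : cross_sum (fun q => - f q) p h = - cross_sum f p h.
  by rewrite /cross_sum; ring.
by rewrite lerN2 ler_norml => /andP[].
Qed.

(** On the axis the slope in x vanishes, so an even extension has the same
    second-order expansion on both sides. *)
Lemma harm_on_even_extension (R : realType) (f : R * R -> R) (D : R) :
  (forall p, `|p.1| < D -> exists2 a, harm_jet f p a & (p.1 = 0 -> a = 0)) ->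
  harm_on [set p | `|p.1| < D] (fun p : R * R => f (`|p.1|, p.2)).
Proof.
move=> H.
have cG (p : R * R) : `|p.1| < D -> {for p, continuous (fun p : R * R => f (`|p.1|, p.2))}.
  move=> pD.
  have c1 : (fun q : R * R => (`|q.1|, q.2)) @ p --> (`|p.1|, p.2).
    apply: (@cvg_pair _ _ _ (nbhs p) (nbhs `|p.1|) (nbhs p.2)); last exact: cvg_snd.
    have c0 : (fun q : R * R => q.1) @ p --> p.1 by exact: cvg_fst.
    exact: (cvg_norm c0).
  have [|a [cf _] _] := H (`|p.1|, p.2); first by rewrite /= normr_id.
  exact: (cvg_comp _ _ c1 cf).
have pos (p : R * R) : 0 <= p.1 -> p.1 < D -> harm (fun p : R * R => f (`|p.1|, p.2)) p.
  move=> p0 pD; apply: harm_of_cross => e e0.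
  have [|a [_ [b [A J]]] a0] := H p; first by rewrite ger0_norm.
  have e40 : 0 < e / 4 by lra.
  have [d d0 Hd] := J _ e40.
  have [p10|pn0] := eqVneq p.1 0.
    near=> h.
    have h0 : 0 < h by [].
    have hd : h < d by near: h; exact: nbhs_right_lt.
    have ph : `|h| < d by rewrite gtr0_norm.
    have nh : `|- h| < d by rewrite normrN gtr0_norm.
    have [+ j1] := Hd _ ph; have [_ +] := Hd _ nh; move: j1.
    rewrite a0// /cross_sum /= p10 add0r sub0r normrN normr0 (gtr0_norm h0).
    have -> : p = (0, p.2) by rewrite -p10 -surjective_pairing.
    rewrite /= sqrrN mul0r !ler_norml.
    by move=> /andP[? ?] /andP[? ?] /andP[? ?]; apply/andP; split; lra.
  have pp : 0 < p.1 by rewrite lt_neqAle eq_sym pn0.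
  near=> h.
  have h0 : 0 < h by [].
  have hp : h < p.1 by near: h; exact: nbhs_right_lt.
  have hd : h < d by near: h; exact: nbhs_right_lt.
  have ph : `|h| < d by rewrite gtr0_norm.
  have nh : `|- h| < d by rewrite normrN gtr0_norm.
  have [+ +] := Hd _ ph; have [+ +] := Hd _ nh.
  rewrite /cross_sum /= (gtr0_norm pp) (@gtr0_norm _ (p.1 + h)); last by lra.
  rewrite (@gtr0_norm _ (p.1 - h)); last by lra.
  rewrite -(surjective_pairing p) sqrrN !ler_norml.
  by move=> /andP[? ?] /andP[? ?] /andP[? ?] /andP[? ?]; apply/andP; split; lra.
move=> p pD; split; first exact: cG.
have [p0|/ltW p0] := leP 0 p.1; first by apply: pos; rewrite // -(ger0_norm p0).
have m0 : 0 <= (- p.1, p.2).1 by rewrite oppr_ge0.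
have mD : (- p.1, p.2).1 < D by rewrite -(ler0_norm p0).
have := harm_reflect (pos _ m0 mD).
by under eq_fun do rewrite /= normrN.
Unshelve. all: by end_near. Qed.

Lemma harm_jet_mirror (R : realType) (f : R * R -> R) (p : R * R) (a : R) :
  harm_jet f (mirror p) a -> harm_jet (fun q => f (mirror q)) p (- a).
Proof.
move=> [cf [b [A J]]]; split.
  exact: (cvg_comp _ _ (@continuous_mirror R p) cf).
exists b, A => e /J[d d0 Hd]; exists d => // t td; split.
  have nt : `|- t| < d by rewrite normrN.
  by have [+ _] := Hd _ nt; rewrite /mirror /= sqrrN opprD mulrN mulNr.
by have [_ +] := Hd _ td.
Qed.

Lemma modulus_le (R : realType) (a b : R) : modulus (a +i* b) <= `|a| + `|b|.
Proof.
rewrite modulusE /= -(@ler_pXn2r _ 2)// ?nnegrE ?sqrtr_ge0 ?addr_ge0//.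
rewrite sqr_sqrtr ?addr_ge0 ?sqr_ge0// sqrrD !real_normK ?num_real//.
have : 0 <= `|a| * `|b| by rewrite mulr_ge0.
lra.
Qed.

Lemma complex_continuous_bound (R : realType) (f : R[i]^o -> R) (z : R[i]) :
  {for z, continuous f} -> exists2 d : R, 0 < d &
    forall w : R[i], modulus (z - w) < d -> `|f w| <= `|f z| + 1.
Proof.
move=> /cvgrPdist_le/(_ _ ltr01) => /nbhs_ballP[e /= e0 He].
move: e0; rewrite ltcE /= => /andP[/eqP Ime Ree].
exists (complex.Re e) => // w zw.
have /He /= : ball (z : R[i]^o) e w.
  by rewrite /ball /= norm_modulus ltcE /= Ime eqxx.
by rewrite distrC => H; have := ler_normD (f w - f z) (f z); rewrite subrK; lra.
Qed.

(** Continuity uses the partial derivatives only: the increment in y is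
    controlled by the mean value theorem and a local bound of h_y, the
    increment in x by differentiability at the point. *)
Lemma harm_jet_C2 (R : realType) (h : R[i] -> R) (D : R) (p : R * R) :
  C2_on (strip D) h -> (forall z, strip D z -> laplacian h z = 0) ->
  `|p.1| < D ->
  harm_jet (fun q => h (toC q)) p (partial_x h (toC p)).
Proof.
move=> [C1h C1hx C1hy] lap pD.
have inS (x y : R) : `|x| < D -> strip D (x +i* y) by [].
pose r := D - `|p.1|.
have r0 : 0 < r by rewrite subr_gt0.
have nearS x : `|x - p.1| < r -> `|x| < D.
  by rewrite /r => H; have := ler_normD (x - p.1) p.1; rewrite subrK; lra.
have dx x y : `|x| < D -> derivable (fun t => h (t +i* y)) x 1.
  by move=> xD; case: (C1h (x +i* y) (inS x y xD)) => + _ _ _; exact.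
have dy x y : `|x| < D -> derivable (fun t => h (x +i* t)) y 1.
  by move=> xD; case: (C1h (x +i* y) (inS x y xD)) => _ + _ _; exact.
have [dxx _ _ _] := C1hx _ (inS p.1 p.2 pD).
have [_ dyy _ _] := C1hy _ (inS p.1 p.2 pD).
have [_ _ _ chy] := C1h _ (inS p.1 p.2 pD).
split; last first.
  exists (partial_y h (toC p)), (2^-1 * partial_x (partial_x h) (toC p)) => e e0.
  have [d1 d10 H1] := taylor2 (g := fun t => h (t +i* p.2)) (a := p.1) r0
    (fun x xr => dx x p.2 (nearS x xr)) dxx e0.
  have [d2 d20 H2] := taylor2 (g := fun t => h (p.1 +i* t)) (a := p.2) r0
    (fun y _ => dy p.1 y pD) dyy e0.
  exists (Num.min d1 d2) => [|t td]; first by rewrite lt_min d10.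
  have t1 : `|t| < d1 by apply: lt_le_trans td _; rewrite ge_min lexx.
  have t2 : `|t| < d2 by apply: lt_le_trans td _; rewrite ge_min lexx orbT.
  split; first exact: H1 t1.
  have := H2 t t2.
  have -> : derive1 (derive1 (fun t => h (p.1 +i* t))) p.2 =
     - partial_x (partial_x h) (toC p).
    have := lap _ (inS p.1 p.2 pD); rewrite /laplacian => /eqP.
    by rewrite addrC addr_eq0 => /eqP.
  by rewrite mulrN mulNr opprK.
apply/cvgrPdist_le => e e0.
have [d1 d10 H1] := complex_continuous_bound chy.
have [d2 d20 H2] := derive1_expansion (dx p.1 p.2 pD) ltr01.
set My := `|partial_y h (p.1 +i* p.2)| + 1 in H1.
set gx := derive1 _ _ in H2.
pose Mx := `|gx| + 1.
have My0 : 0 < My by rewrite ltr_wpDl.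
have Mx0 : 0 < Mx by rewrite ltr_wpDl.
pose d := Num.min (Num.min (d1 / 2) d2) (Num.min r (e / (2 * (Mx + My)))).
have MM0 : 0 < 2 * (Mx + My) by lra.
have d0 : 0 < d by rewrite !lt_min r0 d20 !divr_gt0.
have dd1 : d <= d1 / 2 by rewrite !ge_min lexx.
have dd2 : d <= d2 by rewrite !ge_min lexx orbT.
have dr : d <= r by rewrite !ge_min lexx !orbT.
have de : d * (2 * (Mx + My)) <= e.
  by rewrite -ler_pdivlMr// !ge_min lexx !orbT.
apply: (proj2 (nbhs_ballP p _)); exists d => //= q [q1 q2].
have {}q1 : `|q.1 - p.1| < d by rewrite distrC.
have {}q2 : `|q.2 - p.2| < d by rewrite distrC.
have xinc : `|h (q.1 +i* p.2) - h (p.1 +i* p.2)| <= e / 2.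
  have q12 : `|q.1 - p.1| < d2 by lra.
  have := H2 _ q12; rewrite [p.1 + _]addrC subrK mul1r => Hx.
  set X := q.1 - p.1 in q1 q12 Hx.
  have X1 : `|gx * X| <= `|gx| * d by rewrite normrM ler_wpM2l// ltW.
  have := ler_normD (h (q.1 +i* p.2) - h (p.1 +i* p.2) - gx * X) (gx * X).
  rewrite subrK => X2.
  have := mulr_ge0 (ltW d0) (ltW My0).
  by move: de; rewrite /Mx; lra.
have yinc : `|h (q.1 +i* q.2) - h (q.1 +i* p.2)| <= e / 2.
  have q1D : `|q.1| < D by apply: nearS; lra.
  pose f y := h (q.1 +i* y).
  have Df y : `|y - p.2| < d -> is_derive y 1 f (partial_y h (q.1 +i* y)).
    by move=> _; apply: DeriveDef; [exact: dy|rewrite -derive1E].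
  have [c cp] := MVT_sym Df q2.
  rewrite [p.2 + _]addrC subrK /f => ->.
  rewrite normrM.
  have Hc : `|partial_y h (q.1 +i* c)| <= My.
    apply: H1.
    have -> : p.1 +i* p.2 - q.1 +i* c = (p.1 - q.1) +i* (p.2 - c) by [].
    apply: le_lt_trans (modulus_le _ _) _.
    by rewrite distrC [`|p.2 - c|]distrC; lra.
  have : `|partial_y h (q.1 +i* c)| * `|q.2 - p.2| <= My * d.
    by apply: ler_pM => //; exact: ltW.
  have := mulr_ge0 (ltW d0) (ltW Mx0).
  by move: de; lra.
rewrite /toC distrC.
have -> : h (q.1 +i* q.2) - h (p.1 +i* p.2) =
  (h (q.1 +i* q.2) - h (q.1 +i* p.2)) + (h (q.1 +i* p.2) - h (p.1 +i* p.2)) by ring.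
by apply: le_trans (ler_normD _ _) _; lra.
Qed.

(** * Growth along the imaginary axis *)

Lemma limf_einf_lt (R : realType) (f : R -> \bar R) (e N : R) :
  limf_einf f +oo%R = 0%E -> 0 < e -> exists2 r, N <= r & (f r < e%:E)%E.
Proof.
move=> f0 e0; apply: contrapT => H.
have {}H r : N <= r -> (e%:E <= f r)%E.
  by move=> Nr; rewrite leNgt; apply/negP => fr; apply: H; exists r.
have : (e%:E <= limf_einf f +oo%R)%E; last by rewrite f0 lee_fin leNgt e0.
rewrite limf_einfE.
apply: (@le_trans _ _ (ereal_inf [set f x | x in [set x | N <= x]])).
  by apply: le_ereal_inf_tmp => _ [x Nx <-]; exact: H.
apply: ereal_sup_ubound; exists [set x | N <= x] => //.
exact: nbhs_pinfty_ge (num_real N).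
Qed.

Lemma lne_div_lt (R : realType) (a b r e : R) : 0 < r ->
  (lne (maxe a%:E b%:E) / r%:E < e%:E)%E -> a <= expR (e * r) /\ b <= expR (e * r).
Proof.
move=> r0; rewrite -EFin_max.
have am : a <= Num.max a b by rewrite le_max lexx.
have bm : b <= Num.max a b by rewrite le_max lexx orbT.
move: am bm; set m := Num.max a b => am bm H.
suff : m <= expR (e * r) by split; [exact: le_trans am _|exact: le_trans bm _].
rewrite leNgt; apply/negP => me.
have m0 : 0 < m by apply: lt_trans me; exact: expR_gt0.
move: H; rewrite lne_EFin// inver gt_eqF// -EFinM lte_fin ltr_pdivrMr//.
rewrite ltNge => /negP; apply.
by rewrite -[leLHS]expRK ler_ln ?posrE ?expR_gt0// ltW.
Qed.

(** * Rescaling to the strip of half-width 1 *)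

Lemma even_ridge_rescale (R : realType) (f : R * R -> R) (D : R) : 0 < D ->
  (forall p, `|p.1| < D -> exists2 a, harm_jet f p a & (p.1 = 0 -> a = 0)) ->
  (forall p, `|p.1| < D -> f p <= f (0, p.2)) ->
  (forall t, 0 < t -> exists2 d, 0 < d & forall y, `|y| < d ->
    `|f (0, y) - 2^-1 * y ^+ 2| <= t * y ^+ 2) ->
  (forall N e, 0 < e -> exists2 r, N <= r &
    f (0, r) <= expR (e * r) /\ f (0, - r) <= expR (e * r)) ->
  even_ridge (fun p => D ^- 2 * f (`|D * p.1 + 0|, D * p.2 + 0)).
Proof.
move=> D0 jet rid tay gro.
have D20 : 0 < D ^- 2 by rewrite invr_gt0 exprn_gt0.
split.
- move=> p pD.
  have pD' : `|(D * p.1 + 0, D * p.2 + 0).1| < D.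
    by rewrite /= addr0 normrM gtr0_norm// gtr_pMr.
  have hE := harm_on_even_extension jet.
  have AB (q : R * R) : `|q.1| < 1 -> `|(D * q.1 + 0, D * q.2 + 0).1| < D.
    by move=> q1; rewrite /= addr0 normrM gtr0_norm// gtr_pMr.
  have [c1 c2] := harm_on_affine D0 AB hE pD.
  by split; [exact: cvgMl_tmp c1|exact: harmZ c2].
- by move=> p; rewrite /mirror /= !addr0 mulrN normrN.
- move=> p pD; rewrite ler_pM2l//= mulr0 add0r normr0.
  by apply: rid; rewrite /= normr_id addr0 normrM gtr0_norm// gtr_pMr.
- move=> t /tay[d d0 Hd]; exists (d / D); first by rewrite divr_gt0.
  move=> y yd; rewrite /= mulr0 !addr0 normr0.
  have yD : `|D * y| < d by rewrite normrM gtr0_norm// mulrC -ltr_pdivlMr.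
  have -> : D ^- 2 * f (0, D * y) - 2^-1 * y ^+ 2 =
      D ^- 2 * (f (0, D * y) - 2^-1 * (D * y) ^+ 2).
    by field; rewrite gt_eqF.
  have -> : t * y ^+ 2 = D ^- 2 * (t * (D * y) ^+ 2).
    by field; rewrite gt_eqF.
  by rewrite normrM gtr0_norm// ler_pM2l//; exact: Hd.
(* The rate 1 / (4 D) becomes 1 / 4 after scaling; the other half of the
   rate 1 / 2 absorbs the factor D^-2 at large heights. *)
- move=> N; have e0 : 0 < (4 * D)^-1 by rewrite invr_gt0 mulr_gt0.
  have [r rN [H1 H2]] := gro (D * (`|N| + 4 * D ^- 2)) _ e0.
  exists (r / D).
    rewrite ler_pdivlMr// mulrC; apply: le_trans rN; rewrite ler_pM2l//.
    by have := ler_norm N; lra.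
  rewrite /= mulr0 !addr0 normr0 mulrN.
  have -> : D * (r / D) = r by rewrite mulrC divfK// gt_eqF.
  have rD : 4 * D ^- 2 <= r / D.
    rewrite ler_pdivlMr// mulrC; apply: le_trans rN; rewrite ler_pM2l//.
    by rewrite lerDr.
  have E : expR (r / D / 2) = expR ((4 * D)^-1 * r) * expR ((4 * D)^-1 * r).
    by rewrite -expRD; congr expR; field; rewrite gt_eqF.
  have DE : D ^- 2 <= expR ((4 * D)^-1 * r).
    apply: le_trans (expR_ge1Dx _).
    have -> : (4 * D)^-1 * r = r / D / 4 by field; rewrite gt_eqF.
    lra.
  have E0 : 0 <= D ^- 2 by exact: ltW.
  by rewrite E; split; apply: (le_trans (ler_wpM2l E0 _) (ler_wpM2r _ DE)) => //; exact: expR_ge0.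
Qed.

Theorem theorem1 (R : realType) :
  exists2 c0 : R, 0 < c0 &
  forall (Delta : R) (u : R[i] -> \bar R),
    0 < Delta ->
    subharmonic u ->
    ridge u ->
    limf_einf
      (fun r : R => lne (maxe (u (0%R +i* r)) (u (0%R +i* (- r)%R))) / r%:E)%E
      +oo%R = 0%E ->
    harmonic_on (strip Delta) u ->
    u 0 = 0%E ->
    partial_x (fine \o u) 0 = 0 ->
    partial_y (fine \o u) 0 = 0 ->
    partial_y (partial_y (fine \o u)) 0 = 1 ->
    forall z : R[i], modulus z <= Delta / 3 ->
      (`|u z + (complex.Re (z ^+ 2 / 2))%:E|
         <= (c0 * modulus z ^+ 3 / Delta)%:E)%E.
Proof.
have [c0 c00 Hc] := er_cubic R.
exists c0 => // D u D0 _ rid gro [_ fin C2 lap] u0 ux uy uyy z zD.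
set h := fine \o u in C2 lap ux uy uyy.
have hE (x y : R) : `|x| < D -> u (x +i* y) = (h (x +i* y))%:E.
  by move=> xD; rewrite /h /= fineK//; exact: fin.
have aD : `|0 : R| < D by rewrite normr0.
have rid' (x y : R) : `|x| < D -> h (x +i* y) <= h (0 +i* y).
  by move=> xD; have := rid (x +i* y); rewrite /= !hE.
pose f (p : R * R) := h (toC p).
have jet p : `|p.1| < D -> harm_jet f p (partial_x h (toC p)).
  by move=> pD; exact: harm_jet_C2 C2 lap pD.
have axis (p : R * R) : `|p.1| < D -> p.1 = 0 -> partial_x h (toC p) = 0.
  move=> pD p10; rewrite /toC p10.
  have zin : (0 : R) \in `](- D), D[ by rewrite in_itv /=; apply/andP; split; lra.
  have dh t : t \in `](- D), D[ -> derivable (fun t => h (t +i* p.2)) t 1.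
    rewrite in_itv /= -ltr_norml => tD.
    by case: C2 => + _ _ => /(_ (t +i* p.2) tD) [+ _ _ _]; exact.
  have mx t : t \in `](- D), D[ -> h (t +i* p.2) <= h (0 +i* p.2).
    by rewrite in_itv /= -ltr_norml; exact: rid'.
  have ND : - D <= D by lra.
  have [_ E] := derive1_at_max ND dh zin mx.
  by rewrite /partial_x derive1E; exact: E.
have tay t : 0 < t -> exists2 d, 0 < d & forall y, `|y| < d ->
    `|f (0, y) - 2^-1 * y ^+ 2| <= t * y ^+ 2.
  move=> t0.
  have dy (y : R) : `|y - 0| < 1 -> derivable (fun t => h (0 +i* t)) y 1.
    by move=> _; case: C2 => + _ _ => /(_ (0 +i* y) aD) [_ + _ _]; exact.
  have dyy : derivable (derive1 (fun t => h (0 +i* t))) 0 1.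
    by case: C2 => _ _ => /(_ (0 +i* 0) aD) [_ + _ _]; exact.
  have [d d0 T] := taylor2 ltr01 dy dyy t0.
  exists d => // y /T; rewrite add0r.
  have -> : derive1 (fun t => h (0 +i* t)) 0 = 0 by exact: uy.
  have -> : derive1 (derive1 (fun t => h (0 +i* t))) 0 = 1 by exact: uyy.
  have -> : h (0 +i* 0) = 0 by rewrite /h /= u0.
  by rewrite mul0r !subr0 mulr1.
have gro' N e : 0 < e -> exists2 r, N <= r &
    f (0, r) <= expR (e * r) /\ f (0, - r) <= expR (e * r).
  move=> e0; have [r rN] := limf_einf_lt (Num.max N 1) gro e0.
  rewrite !hE// => H; exists r; first by apply: le_trans rN; rewrite le_max lexx.
  apply: lne_div_lt => //.
  by apply: lt_le_trans rN; rewrite lt_max ltr01 orbT.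
set x := complex.Re z; set y := complex.Im z.
have zE : z = x +i* y by rewrite /x /y; case: (z).
have xz : `|x| <= modulus z by exact: Re_le_modulus.
have xD : `|x| < D by apply: le_lt_trans xz _; lra.
have m0 := modulus_ge0 z.
(* g is the even extension from the side of the axis where z lies. *)
have core (g : R * R -> R) : g (`|x|, y) = h z ->
    even_ridge (fun p => D ^- 2 * g (`|D * p.1 + 0|, D * p.2 + 0)) ->
    `|h z + 2^-1 * (x ^+ 2 - y ^+ 2)| <= c0 * modulus z ^+ 3 / D.
  move=> gz er; pose q := (x / D, y / D).
  have Dn0 : D != 0 by rewrite gt_eqF.
  have Dq (t : R) : D * (t / D) = t by rewrite mulrC divfK.
  have qz : toC q = (D^-1)%:C * z.
    by rewrite zE; apply/eqP; rewrite eq_complex /=; apply/andP; split; apply/eqP; ring.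
  have mq : modulus (toC q) = modulus z / D.
    by rewrite qz modulusM modulusC gtr0_norm ?invr_gt0// mulrC.
  have dq : disc (1 / 3) q.
    have D0' := ltW D0.
    rewrite /disc /= sqnorm_toC mq lerXn2r// ?nnegrE ?divr_ge0//.
    by rewrite ler_pdivrMr//; lra.
  have := Hc _ q er dq; rewrite /= !addr0 !Dq gz mq => H.
  have D2 : 0 < D ^+ 2 by rewrite exprn_gt0.
  rewrite -(ler_pM2l (_ : 0 < D ^- 2)) ?invr_gt0//.
  have -> : D ^- 2 * (c0 * modulus z ^+ 3 / D) = c0 * (modulus z / D) ^+ 3.
    by field.
  apply: le_trans H; rewrite -[D ^- 2 in X in X <= _]gtr0_norm ?invr_gt0//.
  rewrite -normrM le_eqVlt; apply/orP; left; apply/eqP; congr (`|_|).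
  by field.
have main : `|h z + 2^-1 * (x ^+ 2 - y ^+ 2)| <= c0 * modulus z ^+ 3 / D.
  have [x0|x0] := leP 0 x.
    apply: (core f); first by rewrite /f /toC /= ger0_norm// -zE.
    apply: even_ridge_rescale => //.
    - by move=> p pD; exists (partial_x h (toC p)); [exact: jet|exact: axis].
    - by move=> p pD; exact: rid'.
  have mD (p : R * R) : `|p.1| < D -> `|(mirror p).1| < D by rewrite normrN.
  have m1 (p : R * R) : p.1 = 0 -> (mirror p).1 = 0 by move=> /= ->; rewrite oppr0.
  have mir0 (t : R) : mirror (0, t) = (0, t) by rewrite /mirror /= oppr0.
  apply: (core (fun p => f (mirror p))).
    by rewrite /f /toC /= ltr0_norm// opprK -zE.
  apply: (@even_ridge_rescale _ (fun p => f (mirror p)) _ D0) => //.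
  - move=> p pD; exists (- partial_x h (toC (mirror p))).
      by apply: harm_jet_mirror; apply: jet; exact: mD.
    by move=> p1; rewrite axis ?oppr0//; [exact: mD|exact: m1].
  - by move=> p pD; rewrite mir0; apply: rid'; exact: mD.
  - by move=> t /tay[d d0 T]; exists d => // s; rewrite mir0; exact: T.
  - by move=> N e /(gro' N)[r rN H]; exists r => //; rewrite !mir0.
rewrite zE hE// -zE -EFinD abse_EFin lee_fin.
have -> : complex.Re (z ^+ 2 / 2) = 2^-1 * (x ^+ 2 - y ^+ 2).
  have -> : (2 : R[i])^-1 = (2^-1)%:C by rewrite fmorphV rmorph_nat.
  by rewrite zE /=; ring.
exact: main.
Qed.
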